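(* Let $p$ be an odd prime. Every indecomposable Schurian $p$-S-ring $\mathcal A$ over the group $H\cong\mathbb{Z}_p^4$ is $\simeq$-minimal, i.e. the only subgroup $X\le\mathrm{Sym}(H)$ with $H_R\le X$ having the same orbits on $H\times H$ as $\mathrm{Aut}(\mathcal A)$ is $X=\mathrm{Aut}(\mathcal A)$.
   Context: $H$ is written additively; $h_R$ is the translation $x\mapsto x+h$ and $H_R=\{h_R:h\in H\}$. $\mathrm{Cay}(H,S)$ is the digraph on $H$ with arcs $(x,x+s)$, $s\in S$. An S-ring over $H$ is a subalgebra $\mathcal A\subseteq\mathbb{Q}H$ spanned by $\underline{T}=\sum_{t\in T}t$ for $T$ in a partition $\mathrm{Bs}(\mathcal A)$ of $H$ (basic sets) with $\{0\}\in\mathrm{Bs}(\mathcal A)$ and $-T\in\mathrm{Bs}(\mathcal A)$ for all $T\in\mathrm{Bs}(\mathcal A)$. A subgroup $K\le H$ is an $\mathcal A$-subgroup if $\underline K\in\mathcal A$; $\mathrm{rad}(S)=\{h\in H:h+S=S\}$. $\mathcal A$ is a $p$-S-ring if all basic sets have $p$-power size. $\mathrm{Aut}(\mathcal A)=\bigcap_{T\in\mathrm{Bs}(\mathcal A)}\mathrm{Aut}(\mathrm{Cay}(H,T))$. $\mathcal A$ is Schurian if its basic sets are the orbits of $G_0$ (stabilizer of $0$) for some $G\le\mathrm{Sym}(H)$ with $H_R\le G$. If $F\le E$ are $\mathcal A$-subgroups with $F\le\mathrm{rad}(T)$ for every basic set $T\subseteq H\setminus E$, then $\mathcal A$ is an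 $E/F$-wreath product; $\mathcal A$ is decomposable if it is an $E/F$-wreath product for some such $E\ne H$, $F\ne\{0\}$, and indecomposable otherwise. *)

(* Defs.v *)
From mathcomp Require Import all_boot all_order all_algebra all_fingroup.
Set Implicit Arguments. Unset Strict Implicit. Unset Printing Implicit Defensive.
Import GRing.Theory.
Local Open Scope ring_scope.

Section SRings.
Variable H : finZmodType.

Definition ind (S : {set H}) : H -> rat := fun x => if x \in S then 1 else 0.

(* multiplication in the group algebra QH (coefficient functions) *)
Definition conv (f g : H -> rat) : H -> rat :=
  fun z => \sum_(x : H) f x * g (z - x).

(* an element of QH (given by its coefficient function) lies in the
   Q-span of the sums of the blocks of the partition P *)
Definition in_span (P : {set {set H}}) (f : H -> rat) : Prop :=
  forall T, T \in P -> forall x y, x \in T -> y \in T -> f x = f y.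

(* S-ring over H, given by its set of basic sets Bs(A) *)
Definition is_Sring (P : {set {set H}}) : Prop :=
  [/\ partition P [set: H],
      [set 0] \in P,
      (forall T, T \in P -> [set - x | x in T] \in P)
    & (forall T1 T2, T1 \in P -> T2 \in P -> in_span P (conv (ind T1) (ind T2)))].

Definition is_pSring (p : nat) (P : {set {set H}}) : Prop :=
  is_Sring P /\ forall T, T \in P -> exists k : nat, #|T| = (p ^ k)%N.

Definition transl (h : H) : {perm H} := perm (@addIr H h).
Definition HR : {set {perm H}} := [set transl h | h : H].

Definition autCay (T : {set H}) (g : {perm H}) : bool :=
  [forall x : H, forall y : H, (g y - g x \in T) == (y - x \in T)].

Definition AutA (P : {set {set H}}) : {set {perm H}} :=
  [set g : {perm H} | [forall T in P, autCay T g]].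

Definition schurian (P : {set {set H}}) : Prop :=
  exists G : {group {perm H}},
    HR \subset G /\ P = [set orbit 'P 'C_G[0 | 'P] x | x : H].

Definition is_subgroup (K : {set H}) : bool :=
  (0 \in K) && [forall x in K, forall y in K, x - y \in K].

Definition Asubgroup (P : {set {set H}}) (K : {set H}) : Prop :=
  is_subgroup K /\ in_span P (ind K).

Definition rad (S : {set H}) : {set H} :=
  [set h : H | [set h + s | s in S] == S].

Definition wreath (P : {set {set H}}) (E F : {set H}) : Prop :=
  [/\ Asubgroup P E, Asubgroup P F, F \subset E
    & forall T, T \in P -> T \subset ~: E -> F \subset rad T].

Definition decomposable (P : {set {set H}}) : Prop :=
  exists E F : {set H}, [/\ wreath P E F, E != [set: H] & F != [set 0]].

Definition orbit2 (X : {set {perm H}}) (u : H * H) : {set H * H} :=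
  [set ((g : {perm H}) u.1, g u.2) | g in X].

Definition sim_minimal (P : {set {set H}}) : Prop :=
  forall X : {group {perm H}}, HR \subset X ->
    (forall u : H * H, orbit2 X u = orbit2 (AutA P) u) ->
    (X : {set {perm H}}) = AutA P.

End SRings.

(* Main.v *)
(* Let G be the automorphism group of the S-ring, and O x the orbit of x under the stabilizer
   G_0 of 0.  It suffices to find x with G_{0,x} = 1: any X with the same orbits on pairs as G
   then meets every coset of this trivial stabilizer, hence equals G.

   Let T be the group of fixed points of G_0, and consider the upper central series
   0 < T = Z_1 < Z_2 < ... of H, where v lies in Z_(i+1) iff O v is contained in v + Z_i; it is
   strictly increasing because all orbits of G_0 have p-power size.  The key remark is that if g
   in G fixes the coset y + K pointwise and O x is contained in x + K, then the displacement of g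
   at any point of y + x + K lies in the radical of O x; so if this radical is trivial, g also
   fixes y + x + K.  Indecomposability together with Schur's theorem on multipliers
   (O (c x) = c (O x)) provides enough x with trivial radical, and one checks each of the eight
   possible sequences of ranks of the Z_i.  In the only hard case, ranks 1, 2, 3, 4, the orbits
   outside Z_3 are graphs of translates of a function f of two variables over F_p, and a nontrivial
   element of G_{0,x} would make f affine in its second variable; comparing three consecutive
   cosets of Z_3 then gives 4 s = 0 for a nonzero s, which is impossible as p is odd. *)

Require Import Defs.
From HB Require Import structures.
From mathcomp Require Import all_boot all_order all_algebra all_fingroup.
From mathcomp Require Import all_solvable ring zify.
Set Implicit Arguments. Unset Strict Implicit. Unset Printing Implicit Defensive.
Import GRing.Theory.
Local Open Scope ring_scope.

(** * Group algebras and multipliers of suborbits *)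

Section GroupAlgebra.
Variables (R : comNzRingType) (H : finZmodType).

Definition galg : Type := {ffun H -> R}.
HB.instance Definition _ := GRing.Zmodule.on galg.

Definition galg_one : galg := [ffun z => (z == 0)%:R].
Definition galg_mul (f g : galg) : galg := [ffun z => \sum_x f x * g (z - x)].

Lemma galg_mulC : commutative galg_mul.
Proof.
move=> f g; apply/ffunP=> z; rewrite !ffunE.
rewrite (reindex_inj (inv_inj (subKr z))) /=.
by apply: eq_bigr => x _; rewrite subKr mulrC.
Qed.

Lemma galg_mulA : associative galg_mul.
Proof.
move=> f g h; apply/ffunP=> z; rewrite !ffunE.
transitivity (\sum_x \sum_y f x * (g (y - x) * h (z - y))).
  apply: eq_bigr => x _; rewrite ffunE big_distrr /=.
  rewrite (reindex_inj (addIr (- x))) /=.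
  by apply: eq_bigr => y _; rewrite opprB addrA subrK.
rewrite exchange_big /=; apply: eq_bigr => y _.
by rewrite ffunE big_distrl /=; apply: eq_bigr => x _; rewrite mulrA.
Qed.

Lemma galg_mul1 : left_id galg_one galg_mul.
Proof.
move=> f; apply/ffunP=> z; rewrite !ffunE (bigD1 0) //= ffunE eqxx mul1r subr0.
by rewrite big1 ?addr0 // => x /negPf nx; rewrite ffunE nx mul0r.
Qed.

Lemma galg_mulD : left_distributive galg_mul +%R.
Proof.
move=> f g h; apply/ffunP=> z; rewrite !ffunE -big_split /=.
by apply: eq_bigr => x _; rewrite !ffunE mulrDl.
Qed.

Lemma galg_one_neq0 : galg_one != 0.
Proof. by apply/eqP=> /ffunP/(_ 0); rewrite !ffunE eqxx; apply/eqP/oner_neq0. Qed.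

HB.instance Definition _ := GRing.Zmodule_isComNzRing.Build galg
  galg_mulA galg_mulC galg_mul1 galg_mulD galg_one_neq0.

Definition galg_delta (s : H) : galg := [ffun z => (z == s)%:R].

Lemma galg_delta_exp s n : galg_delta s ^+ n = galg_delta (s *+ n).
Proof.
elim: n => [|n IHn]; first by rewrite expr0 mulr0n.
rewrite exprS IHn; apply/ffunP=> z; rewrite !ffunE (bigD1 s) //= !ffunE eqxx mul1r.
rewrite big1 ?addr0 => [|x /negPf nx]; last by rewrite ffunE nx mul0r.
by rewrite subr_eq addrC -mulrS.
Qed.

Lemma galg_char q : q \in [pchar R] -> q \in [pchar galg].
Proof.
case/andP=> q_pr /eqP q0; rewrite inE q_pr; apply/eqP/ffunP=> z.
have -> : (q%:R : galg) z = galg_one z *+ q by rewrite ffunMnE.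
by rewrite -mulr_natr q0 mulr0 ffunE.
Qed.

End GroupAlgebra.

Section Suborbits.
Variables (H : finZmodType) (G : {group {perm H}}).

Definition suborb (x : H) : {set H} := orbit 'P 'C_G[0 | 'P] x.

Lemma suborbP x y :
  reflect (exists g : {perm H}, [/\ g \in G, g 0 = 0 & g x = y]) (y \in suborb x).
Proof.
apply: (iffP orbitP) => [[g /setIP[gG /astab1P g0] gx] | [g [gG g0 gx]]]; exists g => //.
by apply/setIP; split=> //; apply/astab1P.
Qed.

Lemma suborb_refl x : x \in suborb x.
Proof. exact: orbit_refl. Qed.

Lemma suborb_eq x y : y \in suborb x -> suborb y = suborb x.
Proof. by move=> xy; apply/orbit_eqP. Qed.

Lemma suborb_sym x y : (x \in suborb y) = (y \in suborb x).
Proof. exact: orbit_sym. Qed.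

Lemma suborb0 : suborb 0 = [set 0].
Proof.
apply/setP=> y; rewrite inE; apply/suborbP/eqP => [[g [_ -> ]]//|->].
by exists 1%g; rewrite group1 !perm1.
Qed.

Hypothesis HRG : HR H \subset G.

Lemma transl_in h : transl h \in G.
Proof. by apply/(subsetP HRG)/imsetP; exists h. Qed.

(** Composing [g] with translations on both sides gives an element that fixes 0 and takes [z - y] to
    [g z - g y]. *)
Lemma suborb_diff (g : {perm H}) y z : g \in G -> g z - g y \in suborb (z - y).
Proof.
move=> gG; apply/suborbP; exists (transl y * g * transl (- g y))%g.
rewrite !groupM ?transl_in //; split=> //; rewrite !permM !permE ?add0r ?subrr //.
by rewrite subrK.
Qed.

Section Frobenius.
Variable R : comNzRingType.

Let invariant (f : galg R H) :=
  forall g : {perm H}, g \in G -> g 0 = 0 -> forall z, f (g z) = f z.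

Lemma invariant_exp f n : invariant f -> invariant (f ^+ n).
Proof.
move=> f_inv; have f_const z y : y \in suborb z -> f y = f z.
  by case/suborbP=> g [gG g0 <-]; apply: f_inv.
(* The induction needs constancy on suborbits: [g z - g t] lies in the suborbit of [z - t] but need
   not be its image under [g]. *)
suff: forall z y, y \in suborb z -> (f ^+ n) y = (f ^+ n) z.
  by move=> fn_const g gG g0 z; apply: fn_const; apply/suborbP; exists g.
elim: n => [|n IHn] z y.
  case/suborbP=> g [gG g0 <-]; rewrite expr0 !ffunE.
  by congr ((_ : bool)%:R); rewrite -{1}g0 (inj_eq perm_inj).
case/suborbP=> g [gG g0 <-]; rewrite exprS !ffunE (reindex_inj (@perm_inj _ g)) /=.
by apply: eq_bigr => t _; rewrite f_inv // (IHn (z - t)) // suborb_diff.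
Qed.

(* By Frobenius, the q-th power of the sum of the elements of a suborbit is the sum of
   their multiples by q. *)
Lemma suborb_mulrn_char q x : q \in [pchar R] -> injective (fun y : H => y *+ q) ->
  forall y, y \in suborb (x *+ q) -> exists2 z, z \in suborb x & y = z *+ q.
Proof.
move=> qR inj_q y; pose a : galg R H := \sum_(s in suborb x) galg_delta R s.
have aE z : a z = (z \in suborb x)%:R.
  rewrite /a sum_ffunE; case: (boolP (z \in _)) => [xz | nxz].
    rewrite (bigD1 z) //= ffunE eqxx big1 ?addr0 // => t /andP[_ /negPf nt].
    by rewrite ffunE eq_sym nt.
  by rewrite big1 // => t xt; rewrite ffunE; case: eqP => // zt; rewrite zt xt in nxz.
have a_inv : invariant a.
  move=> g gG g0 z; rewrite !aE; congr ((_ : bool)%:R).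
  have zg: g z \in suborb z by apply/suborbP; exists g.
  by rewrite suborb_sym (suborb_eq zg) suborb_sym.
have aq : a ^+ q = \sum_(s in suborb x) galg_delta R (s *+ q).
  rewrite -(pFrobenius_autE (galg_char H qR)) rmorph_sum /=.
  by apply: eq_bigr => s _; rewrite pFrobenius_autE galg_delta_exp.
case/suborbP=> g [gG g0 gy].
(* The coefficients of [a ^+ q] at [x *+ q] and at its image [y] agree, and the first is 1 because
   multiplication by [q] is injective; so [y] is some [z *+ q]. *)
have := @invariant_exp a q a_inv g gG g0 (x *+ q); rewrite gy aq !sum_ffunE.
rewrite [RHS](bigD1 x) ?suborb_refl //= ffunE eqxx [X in _ + X]big1 => [|t /andP[_ ntx]]; last first.
  by rewrite ffunE (inj_eq inj_q) eq_sym (negPf ntx).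
rewrite addr0 => sum1.
have [/exists_inP[z xz /eqP yz] | none] := boolP [exists z in suborb x, y == z *+ q].
  by exists z.
suff /eqP : (1 : R) = 0 by rewrite oner_eq0.
rewrite -[LHS]sum1 big1 // => t xt; rewrite ffunE; case: eqP => // yt.
by case/existsP: none; exists t; rewrite xt; apply/eqP.
Qed.

End Frobenius.
End Suborbits.
(** * Cosets fixed by the stabilizer *)

(** The stabilizer of [x] in [S] has order at most the [p]-part of that in [A]; as the orbit under
    [A] has [p]-power size, the orbit under [S] is at least as large. *)
Lemma sylow_orbit (aT : finGroupType) (T : finType) (to : {action aT &-> T})
    (p : nat) (A S : {group aT}) x :
  prime p -> (p.-Sylow(A) S)%g -> (exists k, #|orbit to A x| = (p ^ k)%N) ->
  orbit to S x = orbit to A x.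
Proof.
move=> p_pr sylS [k Ok]; have [sSA pS _] := and3P sylS.
apply/eqP; rewrite eqEcard imsetS //= Ok.
have := card_Hall sylS; rewrite -(card_orbit_stab to S x) -(card_orbit_stab to A x) Ok.
rewrite partnM ?cardG_gt0 ?expn_gt0 ?(prime_gt0 p_pr) // part_pnat_id ?pnatX ?pnat_id // => cS.
have le : (#|'C_S[x | to]%g| <= #|'C_A[x | to]%g|`_p)%N.
  apply: dvdn_leq; rewrite ?part_gt0 //.
  rewrite -(part_pnat_id (pgroupS (subsetIl S 'C[x | to]%g) pS)).
  by rewrite partn_dvd // cardSg // setSI.
rewrite -(leq_pmul2r (part_gt0 p #|'C_A[x | to]%g|)) -cS.
by rewrite leq_mul2l le orbT.
Qed.

Section FixedCoset.
Variables (H : finZmodType) (G : {group {perm H}}) (p : nat).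
Hypothesis HRG : HR H \subset G.
Hypothesis p_pr : prime p.
Hypothesis pH : (p.-group [set: H])%g.
Hypothesis suborb_pgroup : forall x, exists k, #|suborb G x| = (p ^ k)%N.

(** A Sylow [p]-subgroup of the stabilizer of 0 has the same suborbits and permutes the cosets of
    [K] in [M], whose number is divisible by [p]. It fixes [K], hence also a second coset. *)
Lemma fixed_coset (K M : {group H}) :
    (forall x, x \in K -> suborb G x \subset K) ->
    (forall x, x \in M -> suborb G x \subset M) ->
    K \proper M ->
  exists2 x, x \in M :\: K & forall y, y \in suborb G x -> y - x \in K.
Proof.
move=> invK invM ltKM; have sKM := proper_sub ltKM.
have [S sylS] := Sylow_exists p 'C_G[0 | 'P]%G.
have [sSG pS _] := and3P sylS.
have SE x : orbit 'P S x = suborb G x by apply: sylow_orbit p_pr sylS (suborb_pgroup x).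
have coset_act (g : {perm H}) x : g \in S -> [set g y | y in K :* x]%g = (K :* g x)%g.
  move=> /(subsetP sSG)/setIP[gG /astab1P g0].
  apply/eqP; rewrite eqEcard card_imset; last exact: perm_inj.
  rewrite !card_rcoset leqnn andbT; apply/subsetP=> _ /imsetP[y yx ->].
  move: yx; rewrite !mem_rcoset !FinRing.zmodMgE !FinRing.zmodVgE => yx.
  by apply: (subsetP (invK _ yx)); apply: suborb_diff.
have actsS : [acts S, on rcosets K M | 'P^*]%g.
  apply/subsetP=> g gS; rewrite !inE /=; apply/subsetP=> _ /rcosetsP[x xM ->].
  rewrite inE; apply/rcosetsP; exists (g x); last by rewrite -coset_act.
  by apply: (subsetP (invM _ xM)); rewrite -SE; apply/orbitP; exists g.
have := pgroup_fix_mod pS actsS.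
have /eqP-> : #|rcosets K M| == 0 %[mod p].
  rewrite mod0n; change (p %| #|M : K|%g)%N.
  have /p_natP[[|m] idx] := pnat_dvd (dvdn_indexg M K) (pgroupS (subsetT M) pH).
    by move/eqP: idx; rewrite expn0 indexg_eq1 (negPf (proper_subn ltKM)).
  by rewrite idx dvdn_exp.
set Fx := 'Fix_(_ | _)(_)%g => Fx0.
have inFx x : x \in M -> ((K :* x)%g \in Fx) = [forall y in suborb G x, y - x \in K].
  move=> xM; rewrite inE mem_rcosets mulSGid // xM /=.
  apply/afixP/forall_inP => [fix_x y | fix_x g gS].
    rewrite -SE => /orbitP[g gS <-]; have := fix_x g gS.
    rewrite /= /setact coset_act // => /setP/(_ (g x)).
    rewrite rcoset_refl mem_rcoset => /esym.
    by rewrite FinRing.zmodMgE FinRing.zmodVgE.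
  rewrite /= /setact coset_act //; apply: rcoset_eqP.
  rewrite mem_rcoset FinRing.zmodMgE FinRing.zmodVgE; apply: fix_x.
  by rewrite -SE; apply/orbitP; exists g.
have KFx : (K : {set H}) \in Fx.
  rewrite -[K : {set H}](rcoset1 K) inFx //; apply/forall_inP=> y.
  by rewrite FinRing.zmod1gE suborb0 inE => /eqP->; rewrite subr0; apply: (group1 K).
have /subsetPn[C CFx] : ~~ (Fx \subset [set (K : {set H})]).
  apply/negP=> sub1; move: Fx0; have -> : Fx = [set (K : {set H})].
    by apply/eqP; rewrite eqEsubset sub1 sub1set.
  by rewrite cards1 mod0n modn_small ?prime_gt1.
rewrite inE => nCK.
have /rcosetsP[x xM CE] : C \in rcosets K M by case/setIP: CFx.
rewrite CE inFx // in CFx; exists x; last by apply/forall_inP.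
by rewrite inE xM andbT; apply: contra nCK => xK; rewrite CE rcoset_id.
Qed.
End FixedCoset.
(** * Cocycles over the prime field *)

Section Cocycles.
Variable p : nat.
Hypothesis p_pr : prime p.
Hypothesis p_odd : odd p.
Notation F := 'F_p.

Lemma Fp_natP (c : 'F_p) : exists2 m, (m < p)%N & c = m%:R.
Proof. by exists c; rewrite ?natr_Zp // -[X in (_ < X)%N](Fp_cast p_pr) ltn_ord. Qed.

Lemma Fp_arith (R : F -> F) c : (forall k, R (k + 1) = R k + c) -> forall k, R k = R 0 + k * c.
Proof.
move=> step k; have [m _ ->] := Fp_natP k.
elim: m => [|m IHm]; first by rewrite mul0r addr0.
by rewrite -natr1 step IHm; ring.
Qed.

(** A Cauchy equation: [P] and [Q] differ from [R] by constants, and moving [k'] by one shows that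
    [R] has constant increments. *)
Lemma Fp_separated (P Q R : F -> F) : (forall k k', P k' - Q k = R (k' - k)) ->
  exists s, [/\ forall k, P k = P 0 + k * s, forall k, Q k = Q 0 + k * s
              & forall k, R k = P 0 - Q 0 + k * s].
Proof.
move=> PQR; have QE k : Q k = Q 0 + R k - R 0.
  have e1 : P k - Q k = R 0 by rewrite PQR subrr.
  have e2 : P k - Q 0 = R k by rewrite PQR subr0.
  by rewrite -e1 -e2; ring.
have PE k : P k = Q 0 + R k.
  by have e : P k - Q 0 = R k; [rewrite PQR subr0 | rewrite -e; ring].
have Rarith : forall k, R k = R 0 + k * (R 1 - R 0).
  apply: Fp_arith => k; have := PQR 1 (k + 1); rewrite addrK PE (QE 1) => <-.
  by ring.
exists (R 1 - R 0); split=> k.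
- by rewrite !PE Rarith; ring.
- by rewrite (QE k) Rarith; ring.
by rewrite PE Rarith; ring.
Qed.

Variable f : F -> F -> F.

(** The condition that [(i, j, k, l) -> (i, j + al i, k + be i j, l + ga i j k)] preserves
    [l - f j k] for the difference of any two points whose first coordinates differ by 1. *)
Definition cocycle (al : F -> F) (be : F -> F -> F) (ga : F -> F -> F -> F) :=
  forall i j j' k k', ga (i + 1) j' k' - ga i j k
    = f (j' - j + (al (i + 1) - al i)) (k' - k + (be (i + 1) j' - be i j)) - f (j' - j) (k' - k).

(** For fixed [i], [j], [j'] the identity separates [k] from [k'], so [Fp_separated] applies. The
    slope at [(i, j)] equals that at [(i + 1, j')] for every [j'], which makes it a single
    constant. *)
Lemma cocycle_affine al be ga : cocycle al be ga ->
  exists s, forall i j j',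
  [/\ forall k, ga i j k = ga i j 0 + k * s
    & forall k, f (j' - j + (al (i + 1) - al i)) (k + (be (i + 1) j' - be i j)) - f (j' - j) k
                = ga (i + 1) j' 0 - ga i j 0 + k * s].
Proof.
move=> E; pose sl i j := ga i j 1 - ga i j 0.
have aff i j j' : [/\ forall k, ga i j k = ga i j 0 + k * sl i j, sl (i + 1) j' = sl i j
    & forall k, f (j' - j + (al (i + 1) - al i)) (k + (be (i + 1) j' - be i j)) - f (j' - j) k
                = ga (i + 1) j' 0 - ga i j 0 + k * sl i j].
  have [s [P Q R]] := @Fp_separated (ga (i + 1) j') (ga i j) (fun k =>
    f (j' - j + (al (i + 1) - al i)) (k + (be (i + 1) j' - be i j)) - f (j' - j) k) (E i j j').
  have sE : s = sl i j by rewrite /sl (Q 1); ring.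
  split=> [k||k]; first by rewrite -sE.
    by rewrite /sl (P 1) -/(sl i j) -sE; ring.
  by rewrite R sE.
have slN n : sl n%:R 0 = sl 0 0.
  by elim: n => [//|n IHn]; rewrite -natr1; have [_ -> _] := aff n%:R 0 0.
have slE i j : sl i j = sl 0 0.
  have [_ <- _] := aff i j 0; have [_ -> _] := aff i 0 0.
  by have [n _ ->] := Fp_natP i.
by exists (sl 0 0) => i j j'; have [] := aff i j j'; rewrite slE.
Qed.

Definition slope m := f m 1 - f m 0.
Definition affine m := forall k, f m k = f m 0 + k * slope m.

Lemma affine_shift m m' d s c : (forall k, f m' (k + d) - f m k = c + k * s) ->
  affine m -> affine m' /\ slope m' = slope m + s.
Proof.
move=> shift aff; have E k : f m' k = f m 0 + (k - d) * slope m + c + (k - d) * s.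
  have := shift (k - d); rewrite subrK => /(canRL (subrK _)) ->.
  by rewrite (aff (k - d)); ring.
have sE : slope m' = slope m + s by rewrite [LHS]/slope !E; ring.
by split=> // k; rewrite sE !E; ring.
Qed.

Lemma two_neq0 : (2 : F) != 0.
Proof.
rewrite -(dvdn_pcharf (pchar_Fp p_pr)) gtnNdvd //.
by case: p p_pr p_odd => [|[|[|]]].
Qed.

(** The first triple stands for an element fixing two base points. The second, with its unit jump of
    [al1], links consecutive rows [f m]; the third, with [ga2] not constant in [k], excludes equal
    slopes of the rows. *)
Lemma cocycle_trivial al be ga al1 be1 ga1 al2 be2 ga2 :
    cocycle al be ga -> cocycle al1 be1 ga1 -> cocycle al2 be2 ga2 ->
    al 0 = 0 -> be 0 0 = 0 -> ga 0 0 0 = 0 -> al 1 = 0 -> be 1 0 = 0 -> ga 1 0 0 = 0 ->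
    al1 1 - al1 0 = 1 -> ga2 0 0 1 != ga2 0 0 0 ->
  (forall j, be 0 j = 0) /\ (forall j k, ga 0 j k = 0).
Proof.
move=> E E1 E2 al0 be00 ga000 al1_0 be10 ga100 h1 h2.
have [s sE] := cocycle_affine E; have [s1 s1E] := cocycle_affine E1.
have [s2 s2E] := cocycle_affine E2.
have zero1 : (0 : F) + 1 = 1 by rewrite add0r.
(* At this instance both values of [f] coincide and [ga 1 0 0 = 0], so [ga 0 0 1], which is [s],
   vanishes. *)
have s0 : s = 0.
  have [ga0 _] := sE 0 0 0; have := E 0 0 0 1 0.
  rewrite zero1 al0 al1_0 be00 be10 ga100 ga0 ga000 !subrr !addr0 subrr.
  by move/eqP; rewrite !add0r mul1r oppr_eq0 => /eqP.
have gaE i j k : ga i j k = ga i j 0 by have [gak _] := sE i j 0; rewrite (gak k) s0 mulr0 addr0.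
have fE i j j' k : f (j' - j + (al (i + 1) - al i)) (k + (be (i + 1) j' - be i j))
    - f (j' - j) k = ga (i + 1) j' 0 - ga i j 0.
  by have [_ ->] := sE i j j'; rewrite s0 mulr0 addr0.
have [no_shift | ] := boolP [forall j, forall j', be 1 j' - be 0 j == 0].
  have b1z j' : be 1 j' = 0.
    by move/forallP/(_ 0)/forallP/(_ j')/eqP: no_shift; rewrite be00 subr0.
  have be0 j : be 0 j = 0.
    by move/forallP/(_ j)/forallP/(_ 0)/eqP: no_shift; rewrite b1z sub0r => /eqP; rewrite oppr_eq0 => /eqP.
  split=> // j k; have := fE 0 j 0 0; rewrite zero1 al0 al1_0 b1z be0 ga100 !subr0 !addr0.
  by rewrite subrr gaE sub0r => /esym/eqP; rewrite oppr_eq0 => /eqP.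
case/forallPn=> j0 /forallPn[j0' d0]; set d := be 1 j0' - be 0 j0 in d0.
(* Adding the nonzero [d] to the argument changes this row by a constant. *)
have aff0 : affine (j0' - j0).
  pose c := ga 1 j0' 0 - ga 0 j0 0.
  have step k : f (j0' - j0) (k + d) - f (j0' - j0) k = c.
    by have := fE 0 j0 j0' k; rewrite zero1 al0 al1_0 subrr addr0.
  have arith := @Fp_arith (fun k => f (j0' - j0) (k * d)) c.
  have {}arith k : f (j0' - j0) (k * d) = f (j0' - j0) 0 + k * c.
    rewrite arith ?mul0r // => {}k.
    by have := step (k * d); rewrite mulrDl mul1r => /(canRL (subrK _)) ->; rewrite addrC.
  move=> k; rewrite /slope -[X in f _ X = _](divfK d0) -[X in f _ X - _](divfK d0) !arith.
  by ring.
(* The second triple passes affinity from each row to the next, with slope increment [s1]. *)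
have affS m : affine m -> affine (m + 1) /\ slope (m + 1) = slope m + s1.
  have e k : f (m + 1) (k + (be1 1 m - be1 0 0)) - f m k = ga1 1 m 0 - ga1 0 0 0 + k * s1.
    by have [_] := s1E 0 0 m => /(_ k); rewrite zero1 h1 subr0.
  exact: affine_shift e.
have aff m : affine m.
  have [n _ mE] := Fp_natP (m - (j0' - j0)); rewrite -(subrK (j0' - j0) m) mE addrC.
  by elim: n {mE} => [|n IHn]; rewrite ?addr0 // -natr1 addrA; apply: (affS _ IHn).1.
have [B slopeE] : exists B, forall m, slope m = B + m * s1.
  by exists (slope 0); apply: (@Fp_arith slope) => k; apply: (affS k (aff k)).2.
have s1_neq0 : s1 != 0.
  have [ga2E f2] := s2E 0 0 0; apply: contraNneq h2 => s10.
  have [_] := affine_shift f2 (aff _); rewrite !slopeE s10 !mulr0 !addr0 => /eqP.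
  by rewrite -subr_eq0 opprD addrA subrr sub0r oppr_eq0 ga2E => /eqP->; rewrite mulr0 addr0.
have fD m k e : f m (k + e) - f m k = (B + m * s1) * e.
  by rewrite (aff m (k + e)) (aff m k) slopeE; ring.
have E01 j j' : ga 1 j' 0 - ga 0 j 0 = (B + (j' - j) * s1) * (be 1 j' - be 0 j).
  have := fE 0 j j' 0; rewrite zero1 al0 al1_0 subrr addr0 fD => <-.
  by [].
(* Row [al (1 + 1)] has the same slope as row 0, while distinct rows have distinct slopes since [s1]
   is nonzero. *)
have al2_0 : al (1 + 1) = 0.
  have f12 k : f (0 + al (1 + 1)) (k + (be (1 + 1) 0 - be 1 0)) - f 0 k
      = (ga (1 + 1) 0 0 - ga 1 0 0) + k * 0.
    by have := fE 1 0 0 k; rewrite al1_0 !subr0 mulr0 addr0.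
  have [_] := affine_shift f12 (aff _); rewrite !slopeE mul0r !addr0 add0r => /eqP.
  by rewrite -subr_eq0 addrAC subrr add0r mulf_eq0 (negPf s1_neq0) orbF => /eqP.
have E12 j j' : ga (1 + 1) j' 0 - ga 1 j 0 = (B + (j' - j) * s1) * (be (1 + 1) j' - be 1 j).
  by have := fE 1 j j' 0; rewrite al1_0 al2_0 subrr addr0 fD => <-.
have g1E j : ga 1 j 0 = (B + j * s1) * be 1 j.
  by have := E01 0 j; rewrite ga000 be00 !subr0.
have g0E j : ga 0 j 0 = (B - j * s1) * be 0 j.
  have := E01 j 0; rewrite ga100 be10 !sub0r => /(congr1 -%R).
  by rewrite opprK => ->; ring.
have be01 j j' : j * be 1 j' + j' * be 0 j = 0.
  have := E01 j j'; rewrite g1E g0E => /eqP; rewrite -subr_eq0 => /eqP e.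
  apply: (mulIf s1_neq0); rewrite mul0r -[RHS]e; ring.
pose c := be 1 1.
have be0E j : be 0 j = - (j * c).
  by apply/eqP; rewrite -addr_eq0 addrC -[X in _ + X]mul1r be01.
have be1E j : be 1 j = j * c.
  have := be01 1 j; rewrite be0E => /eqP; rewrite addr_eq0 !mul1r => /eqP ->; ring.
pose b := be (1 + 1) 0.
have g20 : ga (1 + 1) 0 0 = B * b.
  by have := E12 0 0; rewrite g1E be1E /b => /(canRL (subrK _)) ->; ring.
(* One side is linear in [j], the other quadratic; [j = 1] and [j = -1] together give
   [4 * s1 * c = 0]. *)
have bc j : j * (s1 * b) = j * j * (2 * s1 * c).
  have := E12 j 0; rewrite g1E be1E g20 -/b => /eqP; rewrite -subr_eq0 => /eqP e.
  by apply/eqP; rewrite -subr_eq0 -[X in _ == X]e; apply/eqP; ring.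
have c0 : c = 0.
  have e1 : s1 * b = 2 * s1 * c by have := bc 1; rewrite !mul1r.
  have e2 : - (s1 * b) = 2 * s1 * c by have := bc (-1); rewrite mulrNN !mul1r mulN1r.
  have : 2 * s1 * c *+ 2 = 0 by rewrite mulr2n -{1}e2 e1 addNr.
  rewrite -mulr_natr => /eqP; rewrite !mulf_eq0 (negPf two_neq0) (negPf s1_neq0) orbF.
  by move/eqP.
split=> [j|j k]; first by rewrite be0E c0 mulr0 oppr0.
by rewrite gaE g0E be0E c0 mulr0 oppr0 mulr0.
Qed.
End Cocycles.
(** * Radicals and the upper central series *)

Section RowVectors.
Variables (p n : nat).
Hypothesis p_pr : prime p.
Notation H := 'rV['F_p]_n.

Lemma scaleFp_closed (S : H -> Prop) :
  S 0 -> (forall u v, S u -> S v -> S (u + v)) -> forall (c : 'F_p) v, S v -> S (c *: v).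
Proof.
move=> S0 SD c v Sv; have [m _ ->] := Fp_natP p_pr c; rewrite scaler_nat.
by elim: m => [|m IHm]; rewrite ?mulr0n // mulrS; apply: SD.
Qed.

Lemma closed_vspace (S : H -> bool) :
  S 0 -> (forall u v, S u -> S v -> S (u + v)) -> exists K : {vspace H}, forall v, (v \in K) = S v.
Proof.
move=> S0 SD; exists <<enum [set v | S v]>>%VS => v; apply/idP/idP => [/coord_span->|Sv].
  elim/big_ind: _ => // i _; apply: (@scaleFp_closed (fun v => S v)) => //.
  by have := @mem_nth _ 0 (enum [set v | S v]) i; rewrite -cardE ltn_ord mem_enum inE; apply.
by apply: memv_span; rewrite mem_enum inE.
Qed.

Lemma vspace_pgroup : (p.-group [set: H])%g.
Proof. by rewrite /pgroup cardsT card_mx card_Fp // mul1n pnatX pnat_id. Qed.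

Lemma vspace_group_set (K : {vspace H}) : group_set [set v in K].
Proof.
apply/group_setP; split; rewrite ?inE ?mem0v // => u v; rewrite !inE.
by rewrite FinRing.zmodMgE; apply: memvD.
Qed.

Definition vgroup K := Group (vspace_group_set K).

Variable G : {group {perm H}}.
Hypothesis HRG : HR H \subset G.
Hypothesis suborb_pgroup : forall x, exists k, #|suborb G x| = (p ^ k)%N.
Local Notation O := (suborb G).

(** Schur's theorem on multipliers. A multiplier [m < p] is split into primes [q], each handled by
    the Frobenius map in characteristic [q]; as [q < p], multiplication by [q] is injective on
    [H]. *)
Lemma suborb_scale (c : 'F_p) x y : c != 0 -> y \in O x -> c *: y \in O (c *: x).
Proof.
have mulrn_suborb m : (0 < m < p)%N -> forall x y,
    y \in O (x *+ m) -> exists2 z, z \in O x & y = z *+ m.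
  elim/ltn_ind: m => m IHm /andP[m_gt0 m_ltp] {}x {}y.
  have [m1|m_gt1] := leqP m 1; first by rewrite (@anti_leq m 1) ?m1 //; exists y.
  have q_pr := pdiv_prime m_gt1; set q := pdiv m in q_pr.
  have /dvdnP[m' mE] := pdiv_dvd m; rewrite -/q in mE.
  have m'_gt0 : (0 < m')%N by case: (m') mE m_gt0 => // ->.
  have m'_ltm : (m' < m)%N by rewrite mE ltn_Pmulr ?prime_gt1.
  have q_ltp : (q < p)%N by apply: leq_ltn_trans m_ltp; apply: dvdn_leq (pdiv_dvd m).
  rewrite mE mulrnA; case/(suborb_mulrn_char HRG (pchar_Fp q_pr)) => [u v /eqP | z].
    rewrite -!scaler_nat -subr_eq0 -scalerBr scaler_eq0 subr_eq0 => /predU1P[q0|/eqP//].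
    have := dvdn_pcharf (pchar_Fp p_pr) q.
    by rewrite q0 eqxx gtnNdvd ?prime_gt0.
  have m'_in : (0 < m' < p)%N by rewrite m'_gt0 (ltn_trans m'_ltm).
  by move=> /(IHm m' m'_ltm m'_in)[w xw ->] ->; exists w; rewrite ?mulrnA.
(* [mulrn_suborb] divides by [m], so it is used at [c *: x] with [m] representing [c^-1], where
   [(c *: x) *+ m = x]. *)
move=> c_neq0 xy; have [m m_lt cE] := Fp_natP p_pr c^-1.
have m_in : (0 < m < p)%N.
  rewrite m_lt andbT lt0n; apply: contra_eq_neq cE => ->.
  by rewrite invr_eq0.
have : y \in O ((c *: x) *+ m) by rewrite -scaler_nat -cE scalerA mulVf // scale1r.
case/(mulrn_suborb m m_in) => z xz ->.
by rewrite -scaler_nat -cE scalerA mulfV // scale1r.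
Qed.

Lemma suborb_scaleE (c : 'F_p) x y : c != 0 -> (c *: y \in O (c *: x)) = (y \in O x).
Proof.
move=> c_neq0; apply/idP/idP=> [|/suborb_scale->//].
by move/(suborb_scale (invr_neq0 c_neq0)); rewrite !scalerA mulVf // !scale1r.
Qed.

Definition radical x : {set H} := [set r | [forall w in O x, w + r \in O x]].
Local Notation rad := radical.

Lemma radP x r : reflect (forall w, w \in O x -> w + r \in O x) (r \in rad x).
Proof. by rewrite inE; apply: forall_inP. Qed.

Lemma rad0 x : 0 \in rad x.
Proof. by apply/radP=> w; rewrite addr0. Qed.

Lemma radD x u v : u \in rad x -> v \in rad x -> u + v \in rad x.
Proof. by move=> /radP xu /radP xv; apply/radP=> w /xu/xv; rewrite addrA. Qed.

Lemma radZ x (c : 'F_p) r : r \in rad x -> c *: r \in rad x.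
Proof. by apply: (@scaleFp_closed (fun r => r \in rad x)); [apply: rad0 | apply: radD]. Qed.

Lemma rad_suborb x y : y \in O x -> rad y = rad x.
Proof. by move/suborb_eq=> yx; apply/setP=> r; rewrite !inE yx. Qed.

Lemma rad_scale (c : 'F_p) x : c != 0 -> rad (c *: x) = rad x.
Proof.
move=> c_neq0; have sub (d : 'F_p) y r : d != 0 -> r \in rad y -> r \in rad (d *: y).
  move=> d_neq0 /(radZ d^-1)/radP yr; apply/radP=> w.
  rewrite -[w](scale1r) -[1](mulfV d_neq0) -scalerA suborb_scaleE // => /yr.
  by rewrite -(suborb_scaleE _ _ d_neq0) scalerDr !scalerA mulfV // !scale1r.
apply/setP=> r; apply/idP/idP; last exact: sub.
by move/(sub c^-1); rewrite scalerA mulVf // scale1r => ->; rewrite ?invr_neq0.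
Qed.

Definition invariantv (K : {vspace H}) := forall x y, x \in K -> y \in O x -> y \in K.
Local Notation inv := invariantv.

Lemma inv_diff (K : {vspace H}) (g : {perm H}) y z :
  inv K -> g \in G -> z - y \in K -> g z - g y \in K.
Proof. by move=> invK gG /invK; apply; apply: suborb_diff. Qed.

Lemma inv0 : inv 0%VS.
Proof. by move=> x y; rewrite memv0 => /eqP->; rewrite suborb0 inE => /eqP->; rewrite mem0v. Qed.

Lemma inv_full : inv fullv. Proof. by move=> x y _ _; apply: memvf. Qed.

(** Let [g] fix 0, [r] lie in the radical and [w] in [O x]. Then [g^-1] sends [w + g r] to [r] plus
    an element of [O x], which is again in [O x]; applying [g] puts [w + g r] in [O x]. *)
Lemma rad_vspace x : exists2 R : {vspace H}, inv R & forall r, (r \in R) = (r \in rad x).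
Proof.
have [R RE] := @closed_vspace (mem (rad x)) (rad0 x) (@radD x).
exists R => // r s; rewrite !RE => /radP xr /suborbP[g [gG g0 gr]].
apply/radP=> w xw; have gVG : (g^-1)%g \in G by rewrite groupV.
have := suborb_diff HRG s (w + s) gVG; rewrite addrK -[X in _ - (_ X)]gr permK (suborb_eq xw).
move=> /xr; rewrite subrK => /suborb_eq <-; apply/suborbP; exists g.
by rewrite permKV.
Qed.

Lemma fixed_cosetv (K M : {vspace H}) : inv K -> inv M -> (K <= M)%VS -> ~~ (M <= K)%VS ->
  exists x, [/\ x \in M, x \notin K & forall y, y \in O x -> y - x \in K].
Proof.
move=> invK invM sKM /subvPn[v vM vK].
case: (@fixed_coset _ G p HRG p_pr vspace_pgroup suborb_pgroup (vgroup K) (vgroup M)).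
- by move=> x; rewrite inE => xK; apply/subsetP=> y /(invK x y xK); rewrite inE.
- by move=> x; rewrite inE => xM; apply/subsetP=> y /(invM x y xM); rewrite inE.
- apply/properP; split; last by exists v; rewrite inE.
  by apply/subsetP=> u; rewrite !inE; apply: (subvP sKM).
move=> x; rewrite !inE => /andP[xK xM] xfix; exists x; split=> // y /xfix.
by rewrite inE.
Qed.

Ltac vring := apply/rowP=> ?; rewrite !mxE; ring.

Lemma memv_eq (K : {vspace H}) u v : u \in K -> v = u -> v \in K.
Proof. by move=> uK ->. Qed.

(** For invariant [K], the coset [v + K] is fixed by the stabilizer of 0; with [K = 0] these are its
    fixed points. *)
Definition central (K : {vspace H}) v := [forall y in O v, y - v \in K].

Lemma centralP (K : {vspace H}) v : reflect (forall y, y \in O v -> y - v \in K) (central K v).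
Proof. exact: forall_inP. Qed.

Lemma central_act (K : {vspace H}) v (g : {perm H}) y :
  central K v -> g \in G -> g (y + v) - g y - v \in K.
Proof.
move=> /centralP cv gG; apply: cv.
have := suborb_diff HRG y (y + v) gG; by rewrite addrAC subrr add0r.
Qed.

Lemma centralD (K : {vspace H}) u v : central K u -> central K v -> central K (u + v).
Proof.
move=> cu cv; apply/centralP=> y /suborbP[g [gG g0 <-]].
apply: memv_eq (memvD (central_act u cv gG) (central_act 0 cu gG)) _.
by rewrite add0r g0; vring.
Qed.

Lemma upper_central (K : {vspace H}) : inv K -> exists Z : {vspace H},
  [/\ inv Z, (K <= Z)%VS, forall v, (v \in Z) = central K v & (Z <= K)%VS -> K = fullv].
Proof.
move=> invK; have [||Z ZE] := @closed_vspace (central K).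
- by apply/centralP=> y; rewrite suborb0 inE => /eqP->; rewrite subrr mem0v.
- exact: centralD.
have sKZ : (K <= Z)%VS.
  by apply/subvP=> v vK; rewrite ZE; apply/centralP=> y /(invK v y vK) yK; apply: memvB.
exists Z; split=> // [x y|sZK].
  rewrite !ZE => /centralP cx xy; apply/centralP=> w; rewrite (suborb_eq xy) => xw.
  by apply: memv_eq (memvB (cx _ xw) (cx _ xy)) _; vring.
apply/eqP; rewrite eqEsubv subvf /=; apply: contraT => nKf.
have [x [_ /negP xK /centralP cx]] := fixed_cosetv invK inv_full (subvf K) nKf.
by case: xK; apply: (subvP sZK); rewrite ZE.
Qed.

Lemma dim_add_line (K : {vspace H}) y : y \notin K -> \dim (K + <[y]>) = (\dim K).+1.
Proof.
move=> yK; rewrite dimv_disjoint_sum.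
  by rewrite dim_vline; case: eqP yK => [->|_ _]; rewrite ?mem0v // addn1.
apply/eqP; rewrite -subv0; apply/subvP=> u /memv_capP[uK /vlineP[c uE]].
rewrite memv0; apply: contraR yK => u0; rewrite uE in u0 uK.
have c0 : c != 0 by apply: contraNneq u0 => ->; rewrite scale0r.
by rewrite -[y]scale1r -(mulVf c0) -scalerA memvZ.
Qed.

Lemma line_compl (K V : {vspace H}) e v : (K <= V)%VS -> \dim V = (\dim K).+1 ->
  e \in V -> e \notin K -> v \in V -> exists c : 'F_p, v - c *: e \in K.
Proof.
move=> sKV dV eV eK vV.
have /eqP VE : (K + <[e]> == V)%VS.
  by rewrite eqEdim subv_add sKV -memvE eV /= dV dim_add_line.
move: vV; rewrite -VE => /memv_addP[k kK [_ /vlineP[c ->] ->]].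
by exists c; rewrite addrK.
Qed.

(** Modulo [K] the elements of [G] respect differences in [V], so the [d] for which [O x] meets
    [x + d + K] form a subspace. It contains [K] and [d0], and [V] is only one dimension larger than
    [K]. *)
Lemma fiber_full_of (K V : {vspace H}) x d0 : (K <= V)%VS -> \dim V = (\dim K).+1 ->
    (forall v, v \in V -> central K v) -> d0 \in V -> d0 \notin K -> x + d0 \in O x ->
  forall d, d \in V -> exists2 k, k \in K & x + d + k \in O x.
Proof.
move=> sKV dV cV d0V d0K xd0.
pose S d := (d \in V) && [exists k in K, x + d + k \in O x].
have [||W WE] := @closed_vspace S.
- rewrite /S mem0v; apply/exists_inP; exists 0; rewrite ?mem0v //.
  by rewrite !addr0 suborb_refl.
- move=> d d' /andP[dV' /exists_inP[k kK /[dup] xd /suborbP[a [aG a0 ad]]]].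
  case/andP=> dV'' /exists_inP[k' kK' /suborbP[b [bG b0 bd]]].
  rewrite /S memvD //; apply/exists_inP.
  have cdk : central K (d + k) by apply: cV; rewrite memvD // (subvP sKV).
  exists (k' + (b (x + (d + k)) - b x - (d + k)) + k).
    by rewrite memvD // memvD // central_act.
  rewrite -(suborb_eq xd); apply/suborbP; exists b; split=> //.
  by rewrite -[x + d + k]addrA bd; vring.
have sKW : (K <= W)%VS.
  apply/subvP=> k kK; rewrite WE /S (subvP sKV) //; apply/exists_inP.
  by exists (- k); rewrite ?memvN // addrK suborb_refl.
have sWV : (W <= V)%VS by apply/subvP=> d; rewrite WE => /andP[].
have nsWK : ~~ (W <= K)%VS.
  apply: contra d0K => /subvP; apply; rewrite WE /S d0V; apply/exists_inP.
  by exists 0; rewrite ?mem0v // addr0.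
have /eqP <- : W == V.
  by rewrite eqEdim sWV dV ltn_neqAle (dimvS sKW) andbT (dimv_leqif_sup sKW).
by move=> d; rewrite WE => /andP[_ /exists_inP].
Qed.

Lemma fiber_full (K V : {vspace H}) x : (K <= V)%VS -> \dim V = (\dim K).+1 ->
    (forall v, v \in V -> central K v) -> ~~ central K x ->
    (forall y, y \in O x -> y - x \in V) ->
  forall d, d \in V -> exists2 k, k \in K & x + d + k \in O x.
Proof.
move=> sKV dV cV /forall_inPn[y xy yK] xV.
by apply: (fiber_full_of sKV dV cV (xV y xy) yK); rewrite addrC subrK.
Qed.

(** Every element of [G] commutes with the translation by a point fixed by the stabilizer of 0. *)
Lemma thin_suborb t x y : central 0%VS t -> (y \in O (x + t)) = (y - t \in O x).
Proof.
move=> ct; have gt (g : {perm H}) z : g \in G -> g (z + t) = g z + t.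
  move=> gG; have := central_act z ct gG.
  by rewrite memv0 subr_eq0 subr_eq => /eqP->; rewrite addrC.
apply/suborbP/suborbP => -[g [gG g0 gx]]; exists g; split=> //.
  by rewrite -gx gt // addrK.
by rewrite gt // gx subrK.
Qed.

Lemma thin_rad t x : central 0%VS t -> (t \in rad x) = (x + t \in O x).
Proof.
move=> ct; apply/radP/idP => [|xt w xw]; first by apply; apply: suborb_refl.
by rewrite -(suborb_eq xt) thin_suborb // addrK.
Qed.

Lemma rad_thin t x : central 0%VS t -> rad (x + t) = rad x.
Proof.
move=> ct; apply/setP=> r; apply/radP/radP => xr w xw.
  by have := xr (w + t); rewrite !thin_suborb // addrK => /(_ xw); rewrite addrAC addrK.
by move: xw; rewrite !thin_suborb // => /xr; rewrite addrAC.
Qed.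

Lemma inv_thin (T R : {vspace H}) : (forall v, central 0%VS v -> v \in T) -> inv R -> R != 0%VS ->
  exists r, [/\ r \in R, r \in T & r != 0].
Proof.
move=> TE invR R0; have nsR0 : ~~ (R <= 0)%VS by rewrite subv0.
have [r [rR]] := fixed_cosetv inv0 invR (sub0v R) nsR0.
by rewrite memv0 => r0 /centralP /TE rT; exists r.
Qed.

(* If [g] fixes [y + K] pointwise, its displacement at a point of [y + s + K] lies in [rad s]. *)
Lemma fix_span (K E : {vspace H}) (S : H -> Prop) (g : {perm H}) y0 :
    (forall s, S s -> (forall y, y \in O s -> y - s \in K) /\ (forall r, r \in rad s -> r = 0)) ->
    (forall L : {vspace H}, (K <= L)%VS -> (forall s, S s -> s \in L) -> (E <= L)%VS) ->
    g \in G -> (forall k, k \in K -> g (y0 + k) = y0 + k) ->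
  forall e, e \in E -> g (y0 + e) = y0 + e.
Proof.
move=> HS HE gG fix0.
pose fixK y := [forall k, (k \in K) ==> (g (y + k) == y + k)].
have fixKP y : reflect (forall k, k \in K -> g (y + k) = y + k) (fixK y).
  apply: (iffP forall_inP) => h k kK; first by apply/eqP/h.
  by apply/eqP/h.
(* [L] consists of the translations that carry pointwise fixed cosets of [K] to pointwise fixed
   ones. *)
have [||L LE] := @closed_vspace (fun e => [forall y, fixK y ==> fixK (y + e)]).
- by apply/forall_inP=> y; rewrite addr0.
- move=> u v /forall_inP fu /forall_inP fv; apply/forall_inP=> y /fu/fv.
  by rewrite addrA.
have sKL : (K <= L)%VS.
  apply/subvP=> k kK; rewrite LE; apply/forall_inP=> y /fixKP fy; apply/fixKP=> k' kK'.
  by rewrite -!addrA fy // memvD.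
have sSL s : S s -> s \in L.
  case/HS=> sK rad_s; rewrite LE; apply/forall_inP=> y /fixKP fy; apply/fixKP=> k kK.
  apply/eqP; rewrite -subr_eq0; apply/eqP; apply: rad_s; apply/radP=> w sw.
  (* This point lies in the fixed coset [y + K], so [w] plus the displacement of [g] at [y + s + k]
     is again in [O s]. *)
  have fw : g (y + s + k - w) = y + s + k - w.
    have -> : y + s + k - w = y + (k - (w - s)) by vring.
    by rewrite fy // memvB // sK.
  have := suborb_diff HRG (y + s + k - w) (y + s + k) gG.
  rewrite fw; have -> : y + s + k - (y + s + k - w) = w by vring.
  by rewrite (suborb_eq sw) opprB addrCA.
move=> e /(subvP (HE L sKL sSL)); rewrite LE => /forall_inP/(_ y0).
by move/(_ (introT (fixKP _) fix0))/fixKP/(_ 0 (mem0v _)); rewrite addr0.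
Qed.

Lemma pin (T V : {vspace H}) x (g : {perm H}) : (forall t, t \in T -> central 0%VS t) ->
    (T <= V)%VS -> (forall v, v \in V -> central T v) ->
    (forall v, v \in V -> exists2 t, t \in T & x + v + t \in O x) ->
    (forall t, t \in T -> t \in rad x -> t = 0) ->
    g \in G -> g 0 = 0 -> g x = x ->
  forall v, v \in V -> g (x + v) = x + v.
Proof.
move=> thinT sTV cV fib radT gG g0 gx v vV; have [t tT xw] := fib v vV.
have vtV : v + t \in V by rewrite memvD // (subvP sTV).
have /= dT := central_act x (cV _ vtV) gG.
set w := x + v + t in xw; have wE : w = x + (v + t) by rewrite addrA.
have gw : g w = w + (g (x + (v + t)) - g x - (v + t)) by rewrite gx wE; vring.
have d0 : g (x + (v + t)) - g x - (v + t) = 0.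
  apply: radT => //; rewrite -(rad_suborb xw) thin_rad ?thinT // -gw.
  by apply/suborbP; exists g.
have := central_act (x + v) (thinT _ tT) gG; rewrite memv0 subr_eq0 subr_eq -/w.
rewrite gw d0 addr0 /w => /eqP xvt; apply: (addIr t); rewrite xvt addrC //.
Qed.

Lemma inv_above (K L : {vspace H}) : (forall v, central K v) -> (K <= L)%VS -> inv L.
Proof.
move=> cK sKL x y xL xy; rewrite -(subrK x y) memvD // (subvP sKL) //.
by apply: (centralP _ _ (cK x)).
Qed.

Lemma inv_sub_thin (K : {vspace H}) : (forall v, v \in K -> central 0%VS v) -> inv K.
Proof.
move=> cK x y xK xy; have := centralP _ _ (cK x xK) y xy.
by rewrite memv0 subr_eq0 => /eqP->.
Qed.

(** The [e] with [g (z + e) - g z] in the span for all [g] and [z] are closed under addition, so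
    testing the generators suffices. *)
Lemma span_inv (X : {set H}) : (forall x y, x \in X -> y \in O x -> y \in X) ->
  inv <<enum X>>%VS.
Proof.
move=> invX; set L := <<_>>%VS => x y xL.
have [||E EE] := @closed_vspace (fun e => [forall g in G, forall z, (g : {perm H}) (z + e) - g z \in L]).
- by apply/forall_inP=> g gG; apply/forallP=> z; rewrite addr0 subrr mem0v.
- move=> u v /forall_inP uE /forall_inP vE; apply/forall_inP=> g gG; apply/forallP=> z.
  have /forallP/(_ z) uz := uE g gG; have /forallP/(_ (z + u)) vz := vE g gG.
  by apply: memv_eq (memvD uz vz) _; rewrite addrA; vring.
have /subvP/(_ x xL) : (L <= E)%VS.
  apply/span_subvP=> e; rewrite mem_enum EE => eX.
  apply/forall_inP=> g gG; apply/forallP=> z; apply: memv_span; rewrite mem_enum.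
  have := suborb_diff HRG z (z + e) gG; rewrite addrAC subrr add0r; exact: invX.
rewrite EE => /forall_inP xE /suborbP[g [gG g0 <-]].
by have /forallP/(_ 0) := xE g gG; rewrite add0r g0 subr0.
Qed.

Definition base2 := exists x, forall g : {perm H}, g \in G -> g 0 = 0 -> g x = x -> forall y, g y = y.

Hypothesis indecomposable : forall E F : {vspace H}, inv E -> inv F -> (F <= E)%VS ->
  E != fullv -> F != 0%VS -> exists x r, [/\ x \notin E, r \in F & r \notin rad x].

Lemma neq_fullv (K V : {vspace H}) : \dim K != \dim V -> K != V.
Proof. by apply: contraNneq => ->. Qed.

(** * The sequences of ranks *)

Lemma thin_base2 : (forall v, central 0%VS v) -> base2.
Proof.
move=> c0; exists 0 => g gG g0 _ y; have := central_act 0 (c0 y) gG.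
by rewrite add0r g0 subr0 memv0 subr_eq0 => /eqP.
Qed.

(** A nonzero radical [R] would contradict indecomposability for [U] and [R]: each point outside [U]
    is a multiple of a point of [x + U], so its radical is [R] too. *)
Lemma rad_const_triv (U : {vspace H}) x : inv U -> \dim {:H} = (\dim U).+1 -> x \notin U ->
    (forall y, y \in O x -> y - x \in U) -> (forall u, u \in U -> rad (x + u) = rad x) ->
  forall r, r \in rad x -> r = 0.
Proof.
move=> invU dU xU sxU radxU r rx; have [R invR RE] := rad_vspace x.
have sRU : (R <= U)%VS.
  apply/subvP=> s; rewrite RE => /radP/(_ x (suborb_refl G x))/sxU.
  by rewrite addrAC subrr add0r.
apply/eqP; rewrite -memv0; have [<-|R0] := eqVneq R 0%VS; first by rewrite RE.
have nU : U != fullv by apply: neq_fullv; rewrite dU ltn_eqF.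
have [y [s [yU sR]]] := indecomposable invU invR sRU nU R0.
have [c ycx] := line_compl (subvf U) dU (memvf x) xU (memvf y).
have c0 : c != 0 by apply: contraNneq yU => c0; move: ycx; rewrite c0 scale0r subr0.
have -> : y = c *: (x + c^-1 *: (y - c *: x)).
  by rewrite scalerDr scalerA mulfV // scale1r addrC subrK.
by rewrite rad_scale // radxU ?memvZ // -RE sR.
Qed.

Lemma fix_hyperplane (U : {vspace H}) x y0 (g : {perm H}) : \dim {:H} = (\dim U).+1 ->
    x \notin U -> (forall y, y \in O x -> y - x \in U) -> (forall r, r \in rad x -> r = 0) ->
    g \in G -> (forall u, u \in U -> g (y0 + u) = y0 + u) ->
  forall y, g y = y.
Proof.
move=> dU xU sx rx gG fixU y; rewrite -(addKr y0 y) addrCA.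
apply: (fix_span (S := eq x) (E := fullv) _ _ gG fixU); last exact: memvf.
  by move=> _ <-; split.
move=> L sUL xL; apply/subvP=> v _.
have [c vcx] := line_compl (subvf U) dU (memvf x) xU (memvf v).
by rewrite -(subrK (c *: x) v) memvD ?(memvZ _ (xL x erefl)) // (subvP sUL).
Qed.

(** These ranks cannot occur: a point [x] outside [T] would have trivial radical by
    [rad_const_triv], yet all differences of [O x] from [x] lie in that radical, so [x] would be in
    [T]. *)
Lemma case_dim34 (T : {vspace H}) : (forall v, (v \in T) = central 0%VS v) ->
  inv T -> \dim {:H} = (\dim T).+1 -> (forall v, central T v) -> base2.
Proof.
move=> TE invT dT cT; have nT : ~~ (fullv <= T)%VS.
  by apply/negP=> /dimvS; rewrite dT ltnn.
have [x _ xT] := subvPn nT; case/negP: (xT).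
have sx y : y \in O x -> y - x \in T by apply: (centralP _ _ (cT x)).
have rx := rad_const_triv invT dT xT sx.
rewrite TE; apply/centralP=> y xy; rewrite memv0; apply/eqP/rx.
  by move=> t; rewrite TE; apply: rad_thin.
by rewrite thin_rad -?TE ?sx // addrC subrK.
Qed.

(** As [O x] meets every coset of [T] in [x + U], the radical is constant on [x + U], hence trivial;
    [pin] then fixes [x + U] pointwise. *)
Lemma case_dim234 (T U : {vspace H}) : (forall v, (v \in T) = central 0%VS v) ->
    (forall v, (v \in U) = central T v) -> (T <= U)%VS -> inv T -> inv U ->
    \dim U = (\dim T).+1 -> \dim {:H} = (\dim U).+1 -> (forall v, central U v) ->
  base2.
Proof.
move=> TE UE sTU invT invU dTU dU cU; have nU : ~~ (fullv <= U)%VS.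
  by apply/negP=> /dimvS; rewrite dU ltnn.
have [x _ xU] := subvPn nU.
have sx y : y \in O x -> y - x \in U by apply: (centralP _ _ (cU x)).
have cT v : v \in U -> central T v by rewrite UE.
have thinT t : t \in T -> central 0%VS t by rewrite TE.
have fib : forall u, u \in U -> exists2 t, t \in T & x + u + t \in O x.
  by apply: (fiber_full sTU dTU cT _ sx); rewrite -UE.
have radx : forall r, r \in rad x -> r = 0.
  apply: (rad_const_triv invU dU xU sx) => u /fib[t tT xut].
  by rewrite -(rad_thin (x + u) (thinT t tT)); apply: rad_suborb.
exists x => g gG g0 gx; apply: (fix_hyperplane (x := x) (y0 := x) dU) => //.
by apply: (pin thinT sTU cT fib) => // t _; apply: radx.
Qed.

Lemma dim1_line (R : {vspace H}) u v : (\dim R <= 1)%N -> u \in R -> u != 0 -> v \in R ->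
  exists c : 'F_p, v = c *: u.
Proof.
move=> dR uR u0 vR; have dR1 : \dim R = (\dim (0%VS : {vspace H})).+1.
  apply/eqP; rewrite dimv0 eqn_leq dR lt0n dimv_eq0.
  by apply: contraNneq u0 => R0; rewrite R0 memv0 in uR.
have u0' : u \notin 0%VS by rewrite memv0.
have [c] := line_compl (sub0v R) dR1 uR u0' vR.
by rewrite memv0 subr_eq0 => /eqP ->; exists c.
Qed.

Lemma mem_eq (A : {set H}) u v : u \in A -> v = u -> v \in A.
Proof. by move=> uA ->. Qed.

Lemma subDD (a b c d : H) : (a + b) - (c + d) = (a - c) + (b - d).
Proof. by rewrite opprD addrACA. Qed.

(* Mod [T] the group [G] acts as translations, with displacements [tau]; three distinct lines
   [rad z1], [rad z2], [rad (z1 + z2)] force [tau] to be additive in each coordinate. *)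
Lemma case_dim24 (T : {vspace H}) : (forall v, (v \in T) = central 0%VS v) ->
  inv T -> \dim T = 2 -> \dim {:H} = 4 -> (forall v, central T v) -> base2.
Proof.
move=> TE invT dT dH cT.
have thinT t : t \in T -> central 0%VS t by rewrite TE.
have sT x y : y \in O x -> y - x \in T by apply: (centralP _ _ (cT x)).
have radT x r : r \in rad x -> r \in T.
  by move=> /radP/(_ x (suborb_refl G x))/sT; rewrite addrAC subrr add0r.
have Orad x y : y \in O x -> y - x \in rad x.
  by move=> xy; rewrite thin_rad ?thinT ?sT // addrC subrK.
have tau_rad z y (c : 'F_p) (g : {perm H}) : g \in G ->
    (g (y + c *: z) - (y + c *: z)) - (g y - y) \in rad z.
  move=> gG; have [->|c0] := eqVneq c 0; first by rewrite scale0r addr0 subrr rad0.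
  rewrite -(rad_scale _ c0) -[_ - _]opprK; have := suborb_diff HRG y (y + c *: z) gG.
  rewrite opprK [y + _ - y]addrAC subrr add0r => /Orad d.
  by apply: mem_eq d _; vring.
have radN x r : r \in rad x -> - r \in rad x by rewrite -scaleN1r; apply: radZ.
have radB x r s : r \in rad x -> s \in rad x -> r - s \in rad x.
  by move=> xr xs; apply: radD => //; apply: radN.
have rad_nontriv y : y \notin T -> exists2 r, r \in rad y & r != 0.
  rewrite TE => /forall_inPn[w yw]; rewrite memv0 => wy.
  by exists (w - y); rewrite ?Orad.
have rad_add x y r : r \in rad (x + y) -> exists a b, [/\ a \in rad x, b \in rad y & r = a + b].
  move=> xyr; have : x + y + r \in O (x + y) by rewrite -thin_rad ?thinT ?(radT _ _ xyr).
  case/suborbP=> g [gG g0 gxy]; exists (g x - x), (r - (g x - x)); split.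
  - by apply: Orad; apply/suborbP; exists g.
  - by apply: mem_eq (tau_rad y x 1 g gG) _; rewrite scale1r gxy; vring.
  - by rewrite addrC subrK.
have rad_line x t : t \in T -> t \notin rad x -> forall u v, u \in rad x -> u != 0 -> v \in rad x ->
    exists c : 'F_p, v = c *: u.
  move=> tT xt u v xu u0 xv; have [R _ RE] := rad_vspace x.
  have sRT : (R <= T)%VS by apply/subvP=> r; rewrite RE; apply: radT.
  apply: (dim1_line (R := R)) => //; rewrite ?RE //.
  suff : (\dim R < \dim T)%N by rewrite dT.
  rewrite ltn_neqAle dimvS // andbT (dimv_leqif_sup sRT); apply: contra xt => /subvP.
  by rewrite -RE; apply.
have rad_disj x y t s : t \in T -> t \notin rad x -> s \in rad x -> s \notin rad y -> forall u,
    u \in rad x -> u \in rad y -> u = 0.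
  move=> tT xt xs ys u xu yu; apply: contraNeq ys => u0.
  by have [c ->] := rad_line x t tT xt u s xu u0 xs; apply: radZ.
have dimT_add y : (\dim (T + <[y]>) <= 3)%N.
  apply: leq_trans (dimv_add_leqif T <[y]>%VS).1 _.
  by rewrite dT dim_vline; case: (y != 0).
have inv_add y : inv (T + <[y]>)%VS by apply: inv_above cT (addvSl _ _).
have add_proper y : (T + <[y]>)%VS != fullv.
  by apply: neq_fullv; rewrite dH neq_ltn ltnS dimT_add.
have [t0 [t0T _ t0n]] : exists t, [/\ t \in T, True & t != 0].
  exists (vpick T); split; rewrite ?memv_pick // vpick0 -dimv_eq0 dT //.
have [y1 [r [y1T rt0 y1r]]] : exists x r, [/\ x \notin T, r \in <[t0]>%VS & r \notin rad x].
  apply: indecomposable; rewrite -?memvE //.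
  - by apply: inv_sub_thin => v /vlineP[c ->]; rewrite -TE memvZ.
  - by apply: neq_fullv; rewrite dT dH.
  - by rewrite -dimv_eq0 dim_vline t0n.
have rT : r \in T by case/vlineP: rt0 => c ->; apply: memvZ.
have [R1 invR1 R1E] := rad_vspace y1.
have sR1T : (R1 <= T)%VS by apply/subvP=> s; rewrite R1E; apply: radT.
have R1n : R1 != 0%VS.
  have [s sy s0] := rad_nontriv y1 y1T; apply: contraNneq s0 => R10.
  by rewrite -memv0 -R10 R1E.
have next y : exists x s, [/\ x \notin (T + <[y]>)%VS, s \in rad y1 & s \notin rad x].
  have [x [s]] := indecomposable (inv_add y) invR1 (subv_trans sR1T (addvSl _ _)) (add_proper y) R1n.
  by rewrite R1E => h; exists x, s.
have [y2 [r2 [y2L y1r2 y2r2]]] := next y1.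
have [y3 [r3 [y3L y1r3 y3r3]]] := next y2.
have y2T : y2 \notin T by apply: contra y2L; apply: (subvP (addvSl _ _)).
have full : (T + <[y1]> + <[y2]>)%VS = fullv.
  by apply/eqP; rewrite eqEdim subvf dimvf -dimvf dH !dim_add_line ?dT.
have span y : exists a b : 'F_p, y - a *: y1 - b *: y2 \in T.
  have : y \in (T + <[y1]> + <[y2]>)%VS by rewrite full memvf.
  case/memv_addP=> _ /memv_addP[t tT [_ /vlineP[a ->] ->]] [_ /vlineP[b ->] ->].
  by exists a, b; apply: memv_eq tT _; vring.
have [a [b y3T]] := span y3.
have a0 : a != 0.
  apply: contraNneq y3L => a0; apply/memv_addP; exists (y3 - a *: y1 - b *: y2) => //.
  by exists (b *: y2); rewrite ?memvZ ?memv_line // a0 scale0r subr0 subrK.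
have b0 : b != 0.
  apply: contraNneq y3r3 => b0; have -> : y3 = a *: y1 + (y3 - a *: y1 - b *: y2).
    by rewrite b0 scale0r subr0 addrC subrK.
  by rewrite rad_thin ?thinT // rad_scale.
(* Rescaling keeps the radicals and makes [z1 + z2] agree with [y3] modulo [T]. *)
have [z1 z1E] : {z | z = a *: y1} by exists (a *: y1).
have [z2 z2E] : {z | z = b *: y2} by exists (b *: y2).
have radz1 : rad z1 = rad y1 by rewrite z1E; apply: rad_scale.
have radz2 : rad z2 = rad y2 by rewrite z2E; apply: rad_scale.
have radz3 : rad (z1 + z2) = rad y3.
  rewrite -(rad_thin _ (thinT _ y3T)); congr rad; rewrite z1E z2E; vring.
have dis12 := rad_disj y1 y2 r r2 rT y1r y1r2 y2r2.
have dis13 := rad_disj y1 y3 r r3 rT y1r y1r3 y3r3.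
(* If the lines [rad y2] and [rad y3] met, they would coincide; [rad y1], contained in their sum,
   would then lie in [rad y3]. *)
have dis23 u : u \in rad y2 -> u \in rad y3 -> u = 0.
  move=> u2 u3; apply/eqP; apply: contraT => u0.
  have [s s1 s0] := rad_nontriv y1 y1T.
  have : s \in rad ((z1 + z2) + (-1) *: z2).
    by rewrite scaleN1r addrK radz1.
  case/rad_add=> s3 [s2 [+ + sE]]; rewrite radz3 rad_scale ?oppr_eq0 ?oner_eq0 // radz2 => s33 s22.
  have [c cE] := rad_line _ _ (radT _ _ y1r2) y2r2 _ _ u2 u0 s22.
  have [d dE] := rad_line _ _ (radT _ _ y1r3) y3r3 _ _ u3 u0 s33.
  by case/eqP: s0; apply: dis13 => //; rewrite sE cE dE radD ?radZ.
exists z1 => g gG g0 gz1.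
have [tau tauE] : {tau : H -> H | forall y, tau y = g y - y} by exists (fun y => g y - y).
have tau0 : tau 0 = 0 by rewrite tauE g0 subrr.
have tauD z y (c : 'F_p) : tau (y + c *: z) - tau y \in rad z by rewrite !tauE; apply: tau_rad.
have tauZ z (c : 'F_p) : tau (c *: z) \in rad z.
  by have := tauD z 0 c; rewrite add0r tau0 subr0.
have tau2 i j : tau (i *: z1 + j *: z2) = tau (i *: z1) + tau (j *: z2).
  apply/eqP; rewrite -subr_eq0; apply/eqP/dis12; rewrite -?radz1 -?radz2.
    have := tauD z1 (j *: z2) i; rewrite (addrC (j *: z2)) => d.
    by apply: mem_eq (radB _ _ _ d (tauZ z1 i)) _; rewrite opprD addrA addrAC.
  by apply: mem_eq (radB _ _ _ (tauD z2 (i *: z1) j) (tauZ z2 j)) _; rewrite opprD addrA.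
(* Increments of [tau] along the two axes. Since [A i + B j] lies in [rad y3], the trivial
   intersections make [A] constant, equal to [A 0 = tau z1 = 0], and then force [B = 0]. *)
have [A AE] : {A : 'F_p -> H | forall i, A i = tau ((i + 1) *: z1) - tau (i *: z1)} by eexists.
have [B BE] : {B : 'F_p -> H | forall j, B j = tau ((j + 1) *: z2) - tau (j *: z2)} by eexists.
have A1 i : A i \in rad y1.
  by rewrite -radz1; apply: mem_eq (tauD z1 (i *: z1) 1) _; rewrite AE scalerDl.
have B2 j : B j \in rad y2.
  by rewrite -radz2; apply: mem_eq (tauD z2 (j *: z2) 1) _; rewrite BE scalerDl.
have AB i j : A i + B j \in rad y3.
  rewrite -radz3; apply: mem_eq (tauD (z1 + z2) (i *: z1 + j *: z2) 1) _.
  rewrite scalerDr addrACA -!scalerDl !tau2 AE BE; exact/esym/subDD.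
have A0 i : A i = 0.
  have -> : A i = A 0.
    apply/eqP; rewrite -subr_eq0; apply/eqP/dis13; first exact: radB.
    by apply: mem_eq (radB _ _ _ (AB i 0) (AB 0 0)) _; rewrite subDD subrr addr0.
  by rewrite AE add0r scale1r scale0r tau0 tauE gz1 subrr subr0.
have B0 j : B j = 0.
  by apply: dis23 => //; have := AB 0 j; rewrite A0 add0r.
have tau_lin z : (forall i : 'F_p, tau ((i + 1) *: z) - tau (i *: z) = 0) ->
    forall i : 'F_p, tau (i *: z) = 0.
  move=> step i; have [m _ ->] := Fp_natP p_pr i.
  elim: m => [|m IHm]; first by rewrite scale0r.
  by move/eqP: (step m%:R); rewrite subr_eq0 natr1 IHm => /eqP.
move=> y; have [i [j yT]] := span y.
have -> : y = ((i / a) *: z1 + (j / b) *: z2) + (y - i *: y1 - j *: y2).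
  by rewrite z1E z2E !scalerA !divfK //; vring.
have := central_act ((i / a) *: z1 + (j / b) *: z2) (thinT _ yT) gG.
have : tau ((i / a) *: z1 + (j / b) *: z2) = 0 
  by rewrite tau2 (tau_lin z1) ?(tau_lin z2) ?addr0 // => k; [rewrite -BE B0 | rewrite -AE A0].
rewrite tauE => /eqP; rewrite subr_eq0 => /eqP->; rewrite memv0 subr_eq0 subr_eq => /eqP->.
exact: addrC.
Qed.

(** * Sequences of ranks in which the fixed points [T] form a line *)

Section ThinLine.
Variable T : {vspace H}.
Hypothesis TE : forall v, (v \in T) = central 0%VS v.
Hypothesis dimT : \dim T = 1.
Hypothesis dimH : \dim {:H} = 4.

Let thinT t : t \in T -> central 0%VS t. Proof. by rewrite TE. Qed.

Lemma thin_line_inv : inv T. Proof. exact: (inv_sub_thin (@thinT)). Qed.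

Lemma thin_line_neq0 : T != 0%VS. Proof. by rewrite -dimv_eq0 dimT. Qed.

(** A nonzero radical is an invariant subspace, so it contains a nonzero fixed point and with it the
    whole line [T]. *)
Lemma rad_thin_line y r0 : r0 \in T -> r0 \notin rad y -> forall r, r \in rad y -> r = 0.
Proof.
move=> r0T yr0 r yr; apply: contraNeq yr0 => rn; have [R invR RE] := rad_vspace y.
have Rn : R != 0%VS by apply: contraNneq rn => R0; rewrite -memv0 -R0 RE.
have thin_sub v : central 0%VS v -> v \in T by rewrite TE.
have [s [sR sT sn]] := inv_thin thin_sub invR Rn.
have dT1 : (\dim T <= 1)%N by rewrite dimT.
have [c ->] := dim1_line dT1 sT sn r0T.
by apply: radZ; rewrite -RE.
Qed.

(** By [rad_thin_line] these are the points outside [T] with trivial radical. *)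
Definition nonrad y := (y \notin T) && [exists r in T, r \notin rad y].

Lemma nonrad_rad y : nonrad y -> forall r, r \in rad y -> r = 0.
Proof. by case/andP=> _ /exists_inP[r rT yr]; apply: rad_thin_line yr. Qed.

Lemma nonrad_scale (c : 'F_p) y : c != 0 -> nonrad y -> nonrad (c *: y).
Proof.
move=> c0 /andP[yT /exists_inP[r rT yr]]; apply/andP; split.
  by apply: contra yT => /(memvZ c^-1); rewrite scalerA mulVf // scale1r.
by apply/exists_inP; exists r; rewrite ?rad_scale.
Qed.

(** For [y] in [V] outside [T], [fiber_full] with [K = 0] shows that [O y] is all of [y + T], so the
    radical contains [T]. *)
Lemma nonrad_notin (V : {vspace H}) : inv V -> (T <= V)%VS -> (forall v, v \in V -> central T v) ->
  forall y, nonrad y -> y \notin V.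
Proof.
move=> invV sTV cV y /andP[yT /exists_inP[r rT yr]]; apply: contra yr => yV.
have dT0 : \dim T = (\dim (0%VS : {vspace H})).+1 by rewrite dimT dimv0.
have ncy : ~~ central 0%VS y by rewrite -TE.
have [k] := fiber_full (sub0v T) dT0 (@thinT) ncy (centralP _ _ (cV y yV)) rT.
by rewrite memv0 => /eqP->; rewrite addr0 thin_rad ?thinT.
Qed.

(** The span of [T] and the [nonrad] points is invariant; were it proper, indecomposability for it
    and [T] would give a [nonrad] point outside it. *)
Lemma nonrad_span (L : {vspace H}) : (T <= L)%VS -> (forall y, nonrad y -> y \in L) -> L = fullv.
Proof.
move=> sTL sSL; pose X := [set y | (y \in T) || nonrad y].
have invX x y : x \in X -> y \in O x -> y \in X.
  rewrite !inE => /orP[xT|/andP[xT /exists_inP[r rT xr]]] xy.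
    by rewrite (thin_line_inv xT xy).
  rewrite /nonrad (rad_suborb xy); apply/orP; right; apply/andP; split.
    by apply: contra xT => yT; apply: (thin_line_inv yT); rewrite suborb_sym.
  by apply/exists_inP; exists r.
set L0 := <<enum X>>%VS; have invL0 := span_inv invX.
have sTL0 : (T <= L0)%VS.
  by apply/subvP=> t tT; apply: memv_span; rewrite mem_enum inE tT.
have : (L0 <= L)%VS.
  apply/span_subvP=> y; rewrite mem_enum inE => /orP[|/sSL//].
  exact: (subvP sTL).
have [-> | nL0] := eqVneq L0 fullv.
  by move=> sL; apply/eqP; rewrite eqEsubv subvf.
have [y [r [yL0 rT yr]]] := indecomposable invL0 thin_line_inv sTL0 nL0 thin_line_neq0.
case/negP: (yL0); apply: memv_span; rewrite mem_enum inE; apply/orP; right.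
apply/andP; split; last by apply/exists_inP; exists r.
by apply: contra yL0; apply: (subvP sTL0).
Qed.

Lemma nonrad_exists : exists y, nonrad y.
Proof.
have [/existsP[y yS]|/existsPn none] := boolP [exists y, nonrad y]; first by exists y.
have Tf : T = fullv by apply: nonrad_span => // y yS; case/negP: (none y).
by move: dimH; rewrite -Tf dimT.
Qed.

(** For a [nonrad] point [x], [pin] fixes [x + V] pointwise, and [fix_span] extends this along the
    [nonrad] points, which together with [V] span [H]. *)
Lemma case_dim124 (V : {vspace H}) : (forall v, (v \in V) = central T v) -> (T <= V)%VS ->
  inv V -> \dim V = 2 -> (forall v, central V v) -> base2.
Proof.
move=> VE sTV invV dV cV; have [x xS] := nonrad_exists.
have cT v : v \in V -> central T v by rewrite VE.
have SV := nonrad_notin invV sTV cT.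
have sV s y : y \in O s -> y - s \in V by apply: (centralP _ _ (cV s)).
exists x => g gG g0 gx y.
have fixV : forall v, v \in V -> g (x + v) = x + v.
  apply: (pin thinT sTV cT) => // [|t _]; last exact: nonrad_rad.
  by apply: (fiber_full sTV _ cT _ (sV x)); rewrite ?dV ?dimT -?VE ?SV.
rewrite -(addKr x y) addrCA; apply: (fix_span (S := nonrad) (E := fullv) _ _ gG fixV).
- by move=> s sS; split; [apply: sV | apply: nonrad_rad].
- by move=> L sVL sSL; rewrite (nonrad_span (subv_trans sTV sVL)).
exact: memvf.
Qed.

(* The displacement [tau] of [g] on [U] is invariant under differences of elements of
   [x + U] whose orbits have trivial radical, and these span. *)
Lemma case_dim134 (U : {vspace H}) : (forall v, (v \in U) = central T v) -> (T <= U)%VS ->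
  inv U -> \dim U = 3 -> (forall v, central U v) -> base2.
Proof.
move=> UE sTU invU dU cU; have [x xS] := nonrad_exists.
have cT v : v \in U -> central T v by rewrite UE.
have SU := nonrad_notin invU sTU cT.
have dHU : \dim {:H} = (\dim U).+1 by rewrite dU dimH.
exists x => g gG g0 gx.
have tauT z : z \in U -> g z - z \in T.
  by move=> /cT cz; have := central_act 0 cz gG; rewrite add0r g0 subr0.
have tauxT z : z - x \in U -> g z - z \in T.
  move=> /cT cz; have := central_act x cz gG; rewrite gx => d.
  by apply: memv_eq d _; rewrite [x + _]addrC subrK; vring.
have tau_step z s : z \in U -> nonrad s -> s - x \in U -> g (z + s) - (z + s) = g z - z.
  move=> zU sS sx; apply/eqP; rewrite -subr_eq0; apply/eqP.
  set d := _ - _; have dT : d \in T.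
    by rewrite memvB ?(tauT z zU) // tauxT // -addrA memvD.
  apply: (nonrad_rad sS); rewrite thin_rad ?thinT //.
  have := suborb_diff HRG z (z + s) gG; rewrite [z + s - z]addrAC subrr add0r => h.
  by apply: mem_eq h _; rewrite /d; vring.
(* [W] collects the periods in [U] of the displacement [z -> g z - z] on [U]. *)
have [||W WE] := @closed_vspace (fun d => (d \in U) && [forall z in U, g (z + d) - (z + d) == g z - z]).
- by rewrite mem0v; apply/forall_inP=> z _; rewrite addr0.
- move=> u v /andP[uU /forall_inP uW] /andP[vU /forall_inP vW]; rewrite memvD //=.
  apply/forall_inP=> z zU; rewrite addrA; apply/eqP.
  by rewrite (eqP (vW _ _)) ?memvD // (eqP (uW _ _)).
have sWU : (W <= U)%VS by apply/subvP=> u; rewrite WE => /andP[].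
have sTW : (T <= W)%VS.
  apply/subvP=> t tT; rewrite WE (subvP sTU) //; apply/forall_inP=> z _.
  have := central_act z (thinT tT) gG; rewrite memv0 subr_eq0 subr_eq => /eqP->.
  by apply/eqP; vring.
have SW s : nonrad s -> s - x \in U -> s - x \in W.
  move=> sS sx; rewrite WE sx; apply/forall_inP=> z zU; apply/eqP.
  have xx : x - x \in U by rewrite subrr mem0v.
  rewrite -(tau_step _ x (memvD zU sx) xS xx) -(tau_step z s zU sS sx).
  by have -> : z + (s - x) + x = z + s by vring.
have WxF : (W + <[x]>)%VS = fullv.
  apply: nonrad_span; first exact: subv_trans sTW (addvSl _ _).
  move=> s sS; have [c sc] := line_compl (subvf U) dHU (memvf x) (SU x xS) (memvf s).
  have c0 : c != 0 by apply: contraNneq (SU s sS) => c0; move: sc; rewrite c0 scale0r subr0.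
  have sE : s - c *: x = c *: (c^-1 *: s - x).
    by rewrite scalerBr scalerA mulfV // scale1r.
  apply/memv_addP; exists (s - c *: x).
    rewrite sE; apply/memvZ/SW; first by rewrite nonrad_scale ?invr_neq0.
    by move: (memvZ c^-1 sc); rewrite sE scalerA mulVf // scale1r.
  by exists (c *: x); rewrite ?memvZ ?memv_line // subrK.
have /eqP WU : W == U.
  have xW : x \notin W by apply: contra (SU x xS); apply: (subvP sWU).
  by rewrite eqEdim sWU -ltnS -(dim_add_line xW) WxF dHU ltnSn.
apply: (fix_hyperplane (x := x) (y0 := 0) dHU (SU x xS)) => //.
- exact: (centralP _ _ (cU x)).
- exact: nonrad_rad.
move=> u; rewrite -WU WE => /andP[_ /forall_inP/(_ 0 (mem0v _))].
by rewrite !add0r g0 subrr subr_eq0 => /eqP.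
Qed.

(** The second base point can be [u] itself: [pin] fixes [u + V], [fix_span] extends this to [U],
    and a point outside [U] with trivial radical extends it to [H]. *)
Lemma case_dim1234_base (V U : {vspace H}) u : (forall v, (v \in V) = central T v) ->
    (forall v, (v \in U) = central V v) -> (T <= V)%VS -> (V <= U)%VS -> inv V -> inv U ->
    \dim V = 2 -> \dim U = 3 -> (forall v, central U v) -> u \in U -> nonrad u ->
  base2.
Proof.
move=> VE UE sTV sVU invV invU dV dU cU uU uS; exists u => g gG g0 gu.
have cT v : v \in V -> central T v by rewrite VE.
have uV := nonrad_notin invV sTV cT uS.
have suV y : y \in O u -> y - u \in V by apply: (centralP _ _ _); rewrite -UE.
have fixV : forall v, v \in V -> g (u + v) = u + v.
  apply: (pin thinT sTV cT) => // [|t _]; last exact: nonrad_rad.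
  by apply: (fiber_full sTV _ cT _ suV); rewrite ?dV ?dimT -?VE.
have fixU v : v \in U -> g v = v.
  move=> vU; rewrite -(addKr u v) addrCA.
  apply: (fix_span (S := eq u) (E := U) _ _ gG fixV); last by rewrite memvD ?memvN.
    by move=> _ <-; split; [apply: suV | apply: nonrad_rad].
  move=> L sVL uL; apply/subvP=> w wU.
  have dUV : \dim U = (\dim V).+1 by rewrite dU dV.
  have [c wc] := line_compl sVU dUV uU uV wU.
  by rewrite -(subrK (c *: u) w) memvD ?(memvZ _ (uL u erefl)) // (subvP sVL).
have nU : U != fullv by apply: neq_fullv; rewrite dU dimH.
have sTU := subv_trans sTV sVU.
have [x [r [xU rT xr]]] := indecomposable invU thin_line_inv sTU nU thin_line_neq0.
have dHU : \dim {:H} = (\dim U).+1 by rewrite dU dimH.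
apply: (fix_hyperplane (x := x) (y0 := 0) dHU xU) => //.
- exact: (centralP _ _ (cU x)).
- exact: rad_thin_line xr.
by move=> k kU; rewrite add0r fixU.
Qed.

(** * Ranks 1, 2, 3, 4 *)

Section Coordinates.
Variables (V U : {vspace H}) (x e1 e2 e3 : H).
Hypothesis p_odd : odd p.
Hypothesis VE : forall v, (v \in V) = central T v.
Hypothesis UE : forall v, (v \in U) = central V v.
Hypotheses (sTV : (T <= V)%VS) (sVU : (V <= U)%VS) (invV : inv V) (invU : inv U).
Hypotheses (dimV : \dim V = 2) (dimU : \dim U = 3) (cU : forall v, central U v).
Hypothesis rad_U : forall u, u \in U -> ~~ nonrad u.
Hypotheses (xS : nonrad x) (e1U : e1 \in U) (e1V : e1 \notin V).
Hypotheses (e2V : e2 \in V) (e2T : e2 \notin T) (e3T : e3 \in T) (e3_neq0 : e3 != 0).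

Definition pt (i j k l : 'F_p) := i *: x + j *: e1 + k *: e2 + l *: e3.

Lemma ptE i j k l : pt i j k l = i *: x + j *: e1 + k *: e2 + l *: e3.
Proof. by []. Qed.

(* Keeps unification from comparing the coordinates of distinct points. *)
Opaque pt.

Lemma xU : x \notin U. Proof. by apply: contraL xS => /rad_U. Qed.

Lemma dimHU : \dim {:H} = (\dim U).+1. Proof. by rewrite dimU dimH. Qed.
Lemma dimUV : \dim U = (\dim V).+1. Proof. by rewrite dimU dimV. Qed.
Lemma dimVT : \dim V = (\dim T).+1. Proof. by rewrite dimV dimT. Qed.

Lemma pt_exists y : exists i j k l, y = pt i j k l.
Proof.
have [i yi] := line_compl (subvf U) dimHU (memvf x) xU (memvf y).
have [j yj] := line_compl sVU dimUV e1U e1V yi.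
have [k yk] := line_compl sTV dimVT e2V e2T yj.
have dT1 : (\dim T <= 1)%N by rewrite dimT.
have [l yl] := dim1_line dT1 e3T e3_neq0 yk.
by exists i, j, k, l; rewrite !ptE -yl; vring.
Qed.

Lemma scale_mem (K : {vspace H}) (c : 'F_p) v : v \notin K -> c *: v \in K -> c = 0.
Proof.
move=> vK cvK; apply: contraNeq vK => c0.
by rewrite -[v]scale1r -(mulVf c0) -scalerA memvZ.
Qed.

Lemma pt_U i j k l : pt i j k l \in U -> i = 0.
Proof.
have /subvP sTU := subv_trans sTV sVU.
rewrite ptE -!addrA rpredDr; first exact/scale_mem/xU.
by rewrite !memvD ?memvZ ?(subvP sVU _ e2V) ?(sTU _ e3T).
Qed.

Lemma pt_V i j k l : pt i j k l \in V -> i = 0 /\ j = 0.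
Proof.
move=> ptV; have i0 := pt_U (subvP sVU _ ptV); split=> //; move: ptV.
rewrite ptE i0 scale0r add0r -!addrA rpredDr; first exact: scale_mem.
by rewrite memvD ?memvZ ?(subvP sTV _ e3T).
Qed.

Lemma pt_T i j k l : pt i j k l \in T -> [/\ i = 0, j = 0 & k = 0].
Proof.
move=> ptT; have [i0 j0] := pt_V (subvP sTV _ ptT); split=> //; move: ptT.
rewrite ptE i0 j0 !scale0r !add0r rpredDr; first exact: scale_mem.
by rewrite memvZ.
Qed.

Lemma ptB i j k l i' j' k' l' :
  pt i j k l - pt i' j' k' l' = pt (i - i') (j - j') (k - k') (l - l').
Proof. by rewrite !ptE; vring. Qed.

Lemma ptD i j k l i' j' k' l' :
  pt i j k l + pt i' j' k' l' = pt (i + i') (j + j') (k + k') (l + l').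
Proof. by rewrite !ptE; vring. Qed.

Lemma pt_inj i j k l i' j' k' l' : pt i j k l = pt i' j' k' l' ->
  [/\ i = i', j = j', k = k' & l = l'].
Proof.
move/eqP; rewrite -subr_eq0 ptB => /eqP e.
have : pt (i - i') (j - j') (k - k') (l - l') \in T by rewrite e mem0v.
case/pt_T=> i0 j0 k0; move: e; rewrite ptE i0 j0 k0 !scale0r !add0r => /eqP.
rewrite scaler_eq0 (negPf e3_neq0) orbF => l0.
by split; apply/eqP; rewrite -subr_eq0 ?i0 ?j0 ?k0.
Qed.

Lemma e3E c : c *: e3 = pt 0 0 0 c. Proof. by rewrite !ptE !scale0r !add0r. Qed.
Lemma xE : x = pt 1 0 0 0. Proof. by rewrite !ptE !scale0r scale1r !addr0. Qed.

Lemma central_TV v : v \in V -> central T v. Proof. by rewrite VE. Qed.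
Lemma central_VU v : v \in U -> central V v. Proof. by rewrite UE. Qed.
Lemma inv_V0 y : y \in O x -> y - x \in U. Proof. exact: (centralP _ _ (cU x)). Qed.

(** As [u] is not [nonrad], its radical contains [T]; since [O u] also meets every coset of [T] in
    [u + V], it contains [u + V]. *)
Lemma orbit_U u v : u \in U -> u \notin V -> v \in V -> u + v \in O u.
Proof.
move=> uU uV vV; have uT : u \notin T by apply: contra uV; apply: (subvP sTV).
have radu t : t \in T -> t \in rad u.
  move=> tT; apply: contraNT (rad_U uU) => tu; rewrite /nonrad uT.
  by apply/exists_inP; exists t.
have suV y : y \in O u -> y - u \in V by apply: (centralP _ _ (central_VU uU)).
have ncu : ~~ central T u by rewrite -VE.
have [t tT uvt] := fiber_full sTV dimVT central_TV ncu suV vV.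
rewrite -(addrK t (u + v)).
by have /radP/(_ _ uvt) : - t \in rad u by apply: radu; rewrite memvN.
Qed.

(* Otherwise [O x] meets each coset of [V] at most once, so at most [p] pairs of its points have
   their difference in [e1 + V]; but all [p ^ 2] elements of [e1 + V] are such differences. *)
Lemma orbit_x_meets : exists v, [/\ v \in V, v \notin T & x + v \in O x].
Proof.
have [/existsP[v /and3P[vV vT xv]]|none] :=
  boolP [exists v, [&& v \in V, v \notin T & x + v \in O x]]; first by exists v.
have once0 v : v \in V -> x + v \in O x -> v = 0.
  move=> vV xv; have vT : v \in T.
    by move/existsPn/(_ v): none; rewrite vV xv andbT negbK.
  by apply: (nonrad_rad xS); rewrite thin_rad ?thinT.
have once y v : y \in O x -> v \in V -> y + v \in O x -> v = 0.
  case/suborbP=> a [aG a0 ax] vV xyv; have aVG : (a^-1)%g \in G by rewrite groupV.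
  have ya : (a^-1)%g y = x by rewrite -ax permK.
  have aV0 : (a^-1)%g 0 = 0 by rewrite -{1}a0 permK.
  set d := (a^-1)%g (y + v) - x.
  have dV : d \in V by rewrite /d -ya; apply: inv_diff => //; rewrite addrAC subrr add0r.
  have d0 : d = 0.
    apply: once0 dV _; rewrite addrC subrK -(suborb_eq xyv).
    by apply/suborbP; exists (a^-1)%g.
  move/eqP: d0; rewrite subr_eq0 -{1}ya (inj_eq perm_inj) -subr_eq0 addrAC subrr add0r.
  by move/eqP.
have ncx : ~~ central V x by rewrite -UE xU.
have [v1 v1V xv1] := fiber_full sVU dimUV central_VU ncx inv_V0 e1U.
pose w := e1 + v1; have wU : w \in U by rewrite memvD // (subvP sVU).
have wV : w \notin V by rewrite rpredDr.
(* If [a] fixes 0 and takes [w] to [w + v], the differences from [-x] to 0 and to [w], both in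
   [O x], become [- a (- x)] and [w + v - a (- x)]. *)
have diffs v : v \in V -> exists2 y, y \in O x & y + (w + v) \in O x.
  move=> vV; have /suborbP[a [aG a0 aw]] := orbit_U wU wV vV.
  exists (- a (- x)).
    by have := suborb_diff HRG (- x) 0 aG; rewrite a0 sub0r sub0r opprK.
  have := suborb_diff HRG (- x) w aG; rewrite aw opprK addrC => h.
  by rewrite (_ : O x = O (w + x)) // -(suborb_eq xv1) /w -addrA [e1 + v1 + x]addrC addrA.
have [Y YE] : exists Y : 'F_p * 'F_p -> H, forall kl : 'F_p * 'F_p,
    Y kl \in O x /\ Y kl + (w + pt 0 0 kl.1 kl.2) \in O x.
  apply: (fin_all_exists (P := fun kl y => y \in O x /\ y + (w + pt 0 0 kl.1 kl.2) \in O x)).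
  case=> k l /=; have vV : pt 0 0 k l \in V.
    by rewrite !ptE !scale0r !add0r memvD ?memvZ // (subvP sTV).
  by have [y xy xyv] := diffs _ vV; exists y.
have [J JE] : exists J : H -> 'F_p, forall y, y \in O x -> y - x - J y *: e1 \in V.
  apply: (fin_all_exists (P := fun y j => y \in O x -> y - x - j *: e1 \in V)) => y.
  have [xy|nxy] := boolP (y \in O x); last by exists 0.
  by have [j yj] := line_compl sVU dimUV e1U e1V (inv_V0 xy); exists j.
have injJY : injective (J \o Y).
  move=> [k l] [k' l'] /= JJ; have [xy xyv] := YE (k, l); have [xy' xyv'] := YE (k', l').
  have Yeq : Y (k', l') = Y (k, l).
    have dV : Y (k', l') - Y (k, l) \in V.
      by apply: memv_eq (memvB (JE _ xy') (JE _ xy)) _; rewrite JJ; vring.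
    have := once _ _ xy dV; rewrite [Y (k, l) + _]addrC subrK => /(_ xy') /eqP.
    by rewrite subr_eq0 => /eqP.
  have /pt_inj[_ _ -> ->] // : pt 0 0 k' l' = pt 0 0 k l.
    apply/eqP; rewrite -subr_eq0; apply/eqP; apply: (once _ _ xyv).
      rewrite ptB !subrr !ptE !scale0r !add0r memvD ?memvZ // (subvP sTV) //.
    by move: xyv'; rewrite /= Yeq => h; apply: mem_eq h _; vring.
have := leq_card _ injJY; rewrite card_prod card_Fp // leqNgt.
by rewrite -[X in (X < _)%N]muln1 ltn_pmul2l ?prime_gt1 ?prime_gt0.
Qed.

(** [fiber_full] gives a point [y] of [O x] in [x + u + V]. Transporting the step of [orbit_x_meets]
    from [x] to [y] gives a step in [V] outside [T], and [fiber_full_of] then leads from [y] into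
    [x + u + T]. *)
Lemma orbit_x_transversal u : u \in U -> exists2 t, t \in T & x + u + t \in O x.
Proof.
move=> uU; have ncx : ~~ central V x by rewrite -UE xU.
have [v vV xuv] := fiber_full sVU dimUV central_VU ncx inv_V0 uU.
set y := x + u + v in xuv; have [v0 [v0V v0T xv0]] := orbit_x_meets.
have /suborbP[a [aG a0 ax]] := xuv.
have cd := central_act x (central_TV v0V) aG.
pose d := a (x + v0) - a x.
have dE : a (x + v0) - a x - v0 \in T := cd.
have dV : d \in V by rewrite -(subrK v0 d) memvD // (subvP sTV).
have dT : d \notin T.
  by apply: contra v0T => dT; apply: memv_eq (memvB dT dE) _; rewrite /d; vring.
have yd : y + d \in O y.
  rewrite /d ax addrC subrK (suborb_eq xuv) -(suborb_eq xv0).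
  by apply/suborbP; exists a.
have nvV : - v \in V by rewrite memvN.
have [t tT yvt] := fiber_full_of sTV dimVT central_TV dV dT yd nvV.
by exists t => //; rewrite -(suborb_eq xuv); apply: mem_eq yvt _; rewrite /y addrK.
Qed.

(** Each [(j, k)] has an [l] with [pt 1 j k l] in [O x], unique because the radical of [x] is
    trivial; the suborbits of the other points of [x + U] are translates of [O x] by [T]. *)
Lemma orbit_x_graph : exists f : 'F_p -> 'F_p -> 'F_p, forall j k j' k' l l',
  pt 1 j' k' l' \in O (pt 1 j k l) -> l' - f j' k' = l - f j k.
Proof.
have [f0 f0E] : exists f0 : 'F_p * 'F_p -> 'F_p, forall jk : 'F_p * 'F_p,
    pt 1 jk.1 jk.2 (f0 jk) \in O x.
  apply: (fin_all_exists (P := fun jk l => pt 1 jk.1 jk.2 l \in O x)) => -[j k] /=.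
  have jkU : pt 0 j k 0 \in U.
    by rewrite !ptE scale0r add0r scale0r addr0 memvD ?memvZ // (subvP sVU).
  have [t tT xt] := orbit_x_transversal jkU.
  have dT1 : (\dim T <= 1)%N by rewrite dimT.
  have [l tE] := dim1_line dT1 e3T e3_neq0 tT.
  by exists l; apply: mem_eq xt _; rewrite tE !ptE; vring.
exists (fun j k => f0 (j, k)) => j k j' k' l l'.
have fE j1 k1 : pt 1 j1 k1 (f0 (j1, k1)) \in O x by apply: (f0E (j1, k1)).
have uniq j1 k1 l1 : pt 1 j1 k1 l1 \in O x -> l1 = f0 (j1, k1).
  move=> xl; apply/eqP; rewrite -subr_eq0; set c := l1 - _.
  have cT : c *: e3 \in T by apply: memvZ.
  have : c *: e3 = 0.
    apply: (nonrad_rad xS); rewrite -(rad_suborb (fE j1 k1)) thin_rad ?thinT //.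
    by rewrite (suborb_eq (fE j1 k1)) e3E ptD !addr0 /c addrC subrK.
  by move/eqP; rewrite scaler_eq0 (negPf e3_neq0) orbF.
have -> : pt 1 j k l = pt 1 j k (f0 (j, k)) + (l - f0 (j, k)) *: e3.
  by rewrite e3E ptD !addr0 addrC subrK.
rewrite thin_suborb ?thinT ?memvZ // (suborb_eq (fE j k)) e3E ptB !subr0 => /uniq <-.
by rewrite opprB addrCA subrr addr0.
Qed.

(** * The stabilizer of 0 in coordinates *)

Section Graph.
Variable f : 'F_p -> 'F_p -> 'F_p.
Hypothesis fE : forall j k j' k' l l',
  pt 1 j' k' l' \in O (pt 1 j k l) -> l' - f j' k' = l - f j k.

Lemma pt_shiftj i j k l j1 : pt i j k l + pt 0 j1 0 0 = pt i (j1 + j) k l.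
Proof. by rewrite !ptE; vring. Qed.

Lemma pt_shiftk i j k l k1 : pt i j k l + pt 0 0 k1 0 = pt i j (k1 + k) l.
Proof. by rewrite !ptE; vring. Qed.

Lemma pt_shiftl i j k l l1 : pt i j k l + pt 0 0 0 l1 = pt i j k (l1 + l).
Proof. by rewrite !ptE; vring. Qed.

Lemma pt_coordinates : exists c1 c2 c3 c4 : H -> 'F_p,
  [/\ forall y, y = pt (c1 y) (c2 y) (c3 y) (c4 y),
      forall y i j k l, y - pt i j k l \in U -> c1 y = i,
      forall y i j k l, y - pt i j k l \in V -> c2 y = j
    & forall y i j k l, y - pt i j k l \in T -> c3 y = k].
Proof.
have [c cE] : exists c : H -> 'F_p * 'F_p * 'F_p * 'F_p, forall y,
    y = pt (c y).1.1.1 (c y).1.1.2 (c y).1.2 (c y).2.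
  apply: (fin_all_exists (P := fun y c => y = pt c.1.1.1 c.1.1.2 c.1.2 c.2)) => y.
  by have [i [j [k [l yE]]]] := pt_exists y; exists (i, j, k, l).
exists (fun y => (c y).1.1.1), (fun y => (c y).1.1.2), (fun y => (c y).1.2), (fun y => (c y).2).
split=> // y i j k l; rewrite {1}[y]cE ptB.
- by move=> /pt_U/eqP; rewrite subr_eq0 => /eqP.
- by move=> /pt_V[_ /eqP]; rewrite subr_eq0 => /eqP.
by move=> /pt_T[_ _ /eqP]; rewrite subr_eq0 => /eqP.
Qed.

(** Centrality of the series makes [a] triangular in the coordinates; [fE], applied to differences
    of points in consecutive cosets of [U], is the cocycle identity. *)
Lemma stab_cocycle (a : {perm H}) : a \in G -> a 0 = 0 -> exists al be ga,
  [/\ cocycle f al be ga,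
      forall i j k l, a (pt i j k l) = pt i (j + al i) (k + be i j) (l + ga i j k)
    & [/\ al 0 = 0, be 0 0 = 0 & ga 0 0 0 = 0]].
Proof.
move=> aG a0; have [c1 [c2 [c3 [c4 [cE cEU cEV cET]]]]] := pt_coordinates.
have [al alE] : {al | forall i, al i = c2 (a (pt i 0 0 0))} by eexists.
have [be beE] : {be | forall i j, be i j = c3 (a (pt i j 0 0))} by eexists.
have [ga gaE] : {ga | forall i j k, ga i j k = c4 (a (pt i j k 0))} by eexists.
have jU j : pt 0 j 0 0 \in U by rewrite !ptE !scale0r add0r !addr0 memvZ.
have kV k : pt 0 0 k 0 \in V by rewrite !ptE !scale0r !add0r !addr0 memvZ.
have lT l : pt 0 0 0 l \in T by rewrite -e3E memvZ.
have /subvP sTU := subv_trans sTV sVU.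
have dU i j k l : a (pt i j k l) - pt i j k l \in U.
  by have := central_act 0 (cU (pt i j k l)) aG; rewrite add0r a0 subr0.
have c1E i j k l : c1 (a (pt i j k l)) = i := cEU _ _ _ _ _ (dU i j k l).
have act0 i : a (pt i 0 0 0) = pt i (al i) (c3 (a (pt i 0 0 0))) (c4 (a (pt i 0 0 0))).
  by rewrite {1}[a (pt i 0 0 0)]cE c1E alE.
have act1 i j : a (pt i j 0 0) = pt i (j + al i) (be i j) (c4 (a (pt i j 0 0))).
  have := central_act (pt i 0 0 0) (central_VU (jU j)) aG.
  rewrite -[_ - _ - _]addrA -opprD pt_shiftj (addr0 j) [X in _ - (X + _)]act0 pt_shiftj.
  by move/cEV=> c2E; rewrite [LHS]cE c1E c2E beE.
have act2 i j k : a (pt i j k 0) = pt i (j + al i) (k + be i j) (ga i j k).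
  have := central_act (pt i j 0 0) (central_TV (kV k)) aG.
  rewrite -[_ - _ - _]addrA -opprD pt_shiftk (addr0 k) [X in _ - (X + _)]act1 pt_shiftk => dT.
  by rewrite [LHS]cE c1E (cEV _ _ _ _ _ (subvP sTV _ dT)) (cET _ _ _ _ _ dT) gaE.
have act i j k l : a (pt i j k l) = pt i (j + al i) (k + be i j) (l + ga i j k).
  have := central_act (pt i j k 0) (thinT (lT l)) aG; rewrite memv0.
  rewrite -[_ - _ - _]addrA -opprD pt_shiftl (addr0 l) [X in _ - (X + _)]act2 pt_shiftl subr_eq0.
  by move/eqP.
have fix0 : a (pt 0 0 0 0) = pt 0 0 0 0 by rewrite -e3E scale0r a0.
exists al, be, ga; split=> //; last first.
  by move: fix0; rewrite act !add0r => /pt_inj[].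
move=> i j j' k k'.
have := suborb_diff HRG (pt i j k 0) (pt (i + 1) j' k' 0) aG.
have -> : pt (i + 1) j' k' 0 - pt i j k 0 = pt 1 (j' - j) (k' - k) 0.
  by rewrite ptB (subr0 0) [i + 1 - i]addrAC (subrr i) (add0r 1).
have -> : a (pt (i + 1) j' k' 0) - a (pt i j k 0) = pt 1 (j' - j + (al (i + 1) - al i))
    (k' - k + (be (i + 1) j' - be i j)) (ga (i + 1) j' k' - ga i j k).
  have sub2 (b c d e : 'F_p) : b + c - (d + e) = b - d + (c - e) by rewrite opprD addrACA.
  rewrite (act i j k) (act (i + 1) j' k') ptB [i + 1 - i]addrAC (subrr i) (add0r 1).
  by rewrite (sub2 j') (sub2 k') (sub2 0 _ 0) (subr0 0) (add0r (_ - _)).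
by move=> /fE; rewrite sub0r => /(canRL (subrK _)) ->; rewrite addrC.
Qed.

Lemma graph_base2 : base2.
Proof.
(* [T] lies in the radical of [e2], as [e2] is not [nonrad]; an element taking [e2] to [e2 + e3]
   provides the nonconstant [ga2]. *)
have e2e3 : e2 + e3 \in O e2.
  rewrite -thin_rad ?thinT //; apply: contraNT (rad_U (subvP sVU _ e2V)) => e2e3.
  by rewrite /nonrad e2T; apply/exists_inP; exists e3.
have e2E : e2 = pt 0 0 1 0 by rewrite !ptE !scale0r scale1r !add0r addr0.
have [a2 [a2G a20 a2e2]] := suborbP _ _ _ e2e3.
have [al2 [be2 [ga2 [E2 act2 [_ be20 ga200]]]]] := stab_cocycle a2G a20.
have ga2_neq : ga2 0 0 1 != ga2 0 0 0.
  have : pt 0 (0 + al2 0) (1 + be2 0 0) (0 + ga2 0 0 1) = pt 0 0 1 1.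
    by rewrite -act2 -e2E a2e2 !ptE; vring.
  by case/pt_inj=> _ _ _; rewrite add0r ga200 => ->; apply: oner_neq0.
(* An element taking [x] into [x + e1 + T] provides the unit jump of [al1]. *)
have e1U' : pt 0 1 0 0 \in U by rewrite !ptE !scale0r scale1r add0r !addr0.
have [t tT xt] := orbit_x_transversal e1U'.
have [a1 [a1G a10 a1x]] := suborbP _ _ _ xt.
have [al1 [be1 [ga1 [E1 act1 [al10 _ _]]]]] := stab_cocycle a1G a10.
have al1_1 : al1 1 - al1 0 = 1.
  have dT1 : (\dim T <= 1)%N by rewrite dimT.
  have [l tE] := dim1_line dT1 e3T e3_neq0 tT.
  have : pt 1 (0 + al1 1) (0 + be1 1 0) (0 + ga1 1 0 0) = pt 1 1 0 l.
    by rewrite -act1 -xE a1x tE !ptE; vring.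
  by case/pt_inj=> _ al11 _ _; rewrite al10 subr0 -(add0r (al1 1)).
exists x => g gG g0 gx.
have [al [be [ga [E act [al0 be00 ga000]]]]] := stab_cocycle gG g0.
have [_ al1E be10 ga100] : [/\ (1 : 'F_p) = 1, al 1 = 0, be 1 0 = 0 & ga 1 0 0 = 0].
  have : pt 1 (0 + al 1) (0 + be 1 0) (0 + ga 1 0 0) = pt 1 0 0 0 by rewrite -act -xE.
  by case/pt_inj; rewrite (add0r (al 1)) (add0r (be 1 0)) (add0r (ga 1 0 0)).
have [be0 ga0] := cocycle_trivial p_pr p_odd E E1 E2 al0 be00 ga000 al1E be10 ga100 al1_1 ga2_neq.
apply: (fix_hyperplane (y0 := 0) dimHU xU inv_V0 (nonrad_rad xS) gG) => u uU.
have [i [j [k [l uE]]]] := pt_exists u; rewrite add0r uE.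
have i0 : i = 0 by apply: (@pt_U i j k l); rewrite -uE.
by rewrite i0 act al0 be0 ga0 !addr0.
Qed.

End Graph.
End Coordinates.

Lemma case_dim1234 (V U : {vspace H}) : odd p -> (forall v, (v \in V) = central T v) ->
    (forall v, (v \in U) = central V v) -> (T <= V)%VS -> (V <= U)%VS -> inv V -> inv U ->
    \dim V = 2 -> \dim U = 3 -> (forall v, central U v) ->
  base2.
Proof.
move=> p_odd VE UE sTV sVU invV invU dV dU cU.
have [/exists_inP[u uU uS]|] := boolP [exists u in U, nonrad u].
  exact: (case_dim1234_base VE UE sTV sVU invV invU dV dU cU uU uS).
move/exists_inPn=> rad_U; have [x xS] := nonrad_exists.
have pick (K M : {vspace H}) : (\dim K < \dim M)%N -> exists2 e, e \in M & e \notin K.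
  by rewrite ltnNge => dKM; apply/subvPn; apply: contra dKM; apply: dimvS.
have [|e1 e1U e1V] := pick V U; first by rewrite dV dU.
have [|e2 e2V e2T] := pick T V; first by rewrite dV dimT.
have [|e3 e3T e30] := pick 0%VS T; first by rewrite dimv0 dimT.
rewrite memv0 in e30.
have [f fE] := orbit_x_graph VE UE sTV sVU invV dV dU cU rad_U xS e1U e1V e2V e2T e3T e30.
exact: (graph_base2 p_odd VE UE sTV sVU invV dV dU cU rad_U xS e1U e1V e2V e2T e3T e30 fE).
Qed.

End ThinLine.

Lemma indecomposable_base2 : odd p -> \dim {:H} = 4 -> base2.
Proof.
move=> p_odd dH.
have [T [invT _ TE T0]] := upper_central inv0.
have dT0 : (0 < \dim T)%N.
  rewrite lt0n dimv_eq0 -subv0; apply/negP=> /T0 full0.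
  by move: dH; rewrite -full0 dimv0.
have [Tf|nTf] := eqVneq T fullv.
  by apply: thin_base2 => v; rewrite -TE Tf memvf.
have lt_full (K : {vspace H}) : K != fullv -> (\dim K < 4)%N.
  move=> nK; suff : (\dim K < \dim {:H})%N by rewrite dH.
  by rewrite ltn_neqAle dimvS ?subvf // andbT (dimv_leqif_eq (subvf K)).
have step (K : {vspace H}) : inv K -> K != fullv -> exists Z : {vspace H},
    [/\ inv Z, (K <= Z)%VS, forall v, (v \in Z) = central K v & (\dim K < \dim Z)%N].
  move=> invK nK; have [Z [invZ sKZ ZE Zf]] := upper_central invK.
  exists Z; split=> //; rewrite ltn_neqAle dimvS // andbT.
  by rewrite (dimv_leqif_sup sKZ); apply: contra nK => /Zf ->.
have full (Z K : {vspace H}) : (forall v, (v \in Z) = central K v) -> Z = fullv ->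
    forall v, central K v by move=> ZE Zf v; rewrite -ZE Zf memvf.
have dfull (Z : {vspace H}) : (3 < \dim Z)%N -> Z = fullv.
  by move=> dZ; apply/eqP; rewrite eqEdim subvf dH.
have [V [invV sTV VE dTV]] := step T invT nTf; have dT4 := lt_full T nTf.
have [Vf|nVf] := eqVneq V fullv.
  have cT := full _ _ VE Vf.
  case dT: (\dim T) dT0 dT4 => [|[|[|[|//]]]] // _ _.
  (* Ranks 1, 4 cannot occur: [nonrad_notin] for the whole space leaves no [nonrad] point. *)
  - have [y yS] := nonrad_exists TE dT dH.
    by have := nonrad_notin TE dT inv_full (subvf T) (fun v _ => cT v) yS; rewrite memvf.
  - exact: case_dim24 TE invT dT dH cT.
  - by apply: (case_dim34 TE invT _ cT); rewrite dH dT.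
have [U [invU sVU UE dVU]] := step V invV nVf; have dV4 := lt_full V nVf.
have [Uf|nUf] := eqVneq U fullv.
  have cV := full _ _ UE Uf.
  case dV: (\dim V) dTV dV4 => [|[|[|[|//]]]] //; first by rewrite ltnNge dT0.
  - rewrite ltnS => dT1 _; have dT : \dim T = 1 by apply/eqP; rewrite eqn_leq dT1.
    exact: (case_dim124 TE dT dH VE sTV invV dV cV).
  - case dT: (\dim T) dT0 => [|[|[|//]]] // _ _ _.
      exact: (case_dim134 TE dT dH VE sTV invV dV cV).
    by apply: (case_dim234 TE VE sTV invT invV _ _ cV); rewrite ?dH dV ?dT.
have [W [_ _ WE dUW]] := step U invU nUf; have dU4 := lt_full U nUf.
have chain a b c : (0 < a < b)%N -> (b < c < 4)%N -> [/\ a = 1, b = 2 & c = 3].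
  by move=> ab bc; split; lia.
have [||dT dV dU] := chain (\dim T) (\dim V) (\dim U); rewrite ?dT0 ?dVU //.
rewrite dU in dUW; have cU := full _ _ WE (dfull W dUW).
exact: (case_dim1234 TE dT dH p_odd VE UE sTV sVU invV invU dV dU cU).
Qed.

End RowVectors.

(** * The automorphism group of the S-ring *)

Section AutGroup.
Variables (H : finZmodType) (P : {set {set H}}).

Lemma AutAP (g : {perm H}) :
  reflect (forall T, T \in P -> forall x y, (g y - g x \in T) = (y - x \in T)) (g \in AutA P).
Proof.
rewrite inE; apply: (iffP forall_inP) => [h T TP x y | h T TP].
  by apply/eqP; move/forallP/(_ x)/forallP: (h T TP).
by apply/forallP=> x; apply/forallP=> y; apply/eqP/h.
Qed.

Lemma AutA_group_set : group_set (AutA P).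
Proof.
apply/group_setP; split=> [|g h /AutAP gP /AutAP hP]; apply/AutAP=> T TP x y.
  by rewrite !perm1.
by rewrite !permM hP ?gP.
Qed.

Canonical AutA_group := Group AutA_group_set.

Lemma HR_sub_AutA : HR H \subset AutA P.
Proof.
apply/subsetP=> _ /imsetP[h _ ->]; apply/AutAP=> T _ x y.
by rewrite !permE opprD addrACA subrr addr0.
Qed.

(** [G] lies in [AutA P], so its suborbits are contained in those of [AutA P]; conversely, elements
    of [AutA P] fixing 0 preserve each basic set, which is a suborbit of [G]. *)
Lemma schurian_suborb : schurian P -> P = [set suborb AutA_group x | x : H].
Proof.
case=> G [HRG PE]; have sGA g : g \in G -> g \in AutA P.
  move=> gG; apply/AutAP=> T; rewrite PE => /imsetP[z _ ->] x y.
  rewrite -!/(suborb G z) -![in LHS](suborb_sym G z) -(suborb_sym G z).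
  by rewrite (suborb_eq (suborb_diff HRG x y gG)).
have suborbE x : suborb AutA_group x = suborb G x.
  apply/setP=> y; apply/suborbP/suborbP=> -[g [gG g0 gx]].
    have TP : suborb G x \in P by rewrite PE; apply/imsetP; exists x.
    have := AutAP _ gG _ TP 0 x.
    by rewrite g0 gx !subr0 suborb_refl => /suborbP.
  by exists g; rewrite sGA.
by rewrite {1}PE; apply: eq_imset => x; rewrite suborbE.
Qed.

Lemma suborb_in_P x : schurian P -> suborb AutA_group x \in P.
Proof. by move/schurian_suborb=> ->; apply/imsetP; exists x. Qed.

End AutGroup.

(* H = Z_p^4, modelled as row vectors of length 4 over F_p *)
Theorem theorem4p1 (p : nat) (p_prime : prime p) (p_odd : odd p)
  (P : {set {set 'rV['F_p]_4}}) :
  is_pSring p P -> schurian P -> ~ decomposable P -> sim_minimal P.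
Proof.
move=> [_ cardP] schP indecP X HRX X2.
pose A := AutA_group P; have HRA : HR 'rV['F_p]_4 \subset A := HR_sub_AutA P.
have PE := schurian_suborb schP.
have OP x : suborb A x \in P := suborb_in_P x schP.
have cardO x : exists k, #|suborb A x| = (p ^ k)%N by apply: cardP.
have indec (E F : {vspace 'rV['F_p]_4}) : invariantv A E -> invariantv A F -> (F <= E)%VS ->
    E != fullv -> F != 0%VS -> exists x r, [/\ x \notin E, r \in F & r \notin radical A x].
  move=> invE invF sFE nE nF.
  have [/existsP[x /existsP[r /and3P[xE rF xr]]]|none] :=
    boolP [exists x, exists r, [&& x \notin E, r \in F & r \notin radical A x]].
    by exists x, r.
  have Asub (K : {vspace 'rV['F_p]_4}) : invariantv A K -> Asubgroup P [set v in K].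
    move=> invK; split.
      apply/andP; split; first by rewrite inE mem0v.
      by apply/forall_inP=> u; rewrite inE => uK; apply/forall_inP=> v; rewrite !inE; apply: memvB.
    move=> T; rewrite PE => /imsetP[z _ ->] u v zu zv; rewrite /ind !inE.
    suff -> : (u \in K) = (v \in K) by [].
    have uv : v \in suborb A u by rewrite (suborb_eq zu).
    apply/idP/idP=> [uK|vK]; first exact: invK uK uv.
    by apply: invK vK _; rewrite suborb_sym.
  case: indecP; exists [set v in E], [set v in F]; split; last 2 first.
  - apply: contraNneq nE => ET; rewrite eqEsubv subvf; apply/subvP=> v _.
    by have := in_setT v; rewrite -ET inE.
  - apply: contraNneq nF => F0; rewrite -subv0; apply/subvP=> v vF.
    by rewrite memv0 -in_set1 -F0 inE.
  split; [exact: Asub | exact: Asub | |].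
    by apply/subsetP=> v; rewrite !inE; apply: (subvP sFE).
  move=> T; rewrite PE => /imsetP[x _ ->] /subsetP xE; apply/subsetP=> r; rewrite !inE => rF.
  have {}xE : x \notin E by have := xE x (suborb_refl A x); rewrite !inE.
  have /radP xr : r \in radical A x.
    by apply: contraR none => xr; apply/existsP; exists x; apply/existsP; exists r; rewrite xE rF.
  have inj_r : injective (fun s : 'rV['F_p]_4 => r + s) by move=> s t /addrI.
  rewrite eqEcard (card_imset _ inj_r) leqnn andbT.
  by apply/subsetP=> _ /imsetP[s xs ->]; rewrite addrC xr.
have dim4 : \dim {: 'rV['F_p]_4} = 4 by rewrite dimvf /dim /= mul1n.
have [x regx] := indecomposable_base2 p_prime HRA cardO indec p_odd dim4.
apply/eqP; rewrite eqEsubset; apply/andP; split; apply/subsetP=> g gX.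
  apply/AutAP=> T TP y z.
  have : (g y, g z) \in orbit2 X (y, z) by apply/imsetP; exists g.
  by rewrite X2 => /imsetP[a /AutAP aP [-> ->]]; apply: aP.
(* Some [h] in [X] agrees with [g] at 0 and at [x], so [g * h^-1] lies in the trivial two-point
   stabilizer. *)
have : (g 0, g x) \in orbit2 (AutA P) (0, x) by apply/imsetP; exists g.
rewrite -X2 => /imsetP[h hX [/= g0 gx]].
have hA : h \in A.
  apply/AutAP=> T TP y z.
  have : (h y, h z) \in orbit2 X (y, z) by apply/imsetP; exists h.
  by rewrite X2 => /imsetP[a /AutAP aP [-> ->]]; apply: aP.
suff -> : g = h by [].
apply/eqP; rewrite eq_mulgV1; apply/eqP/permP=> y; rewrite perm1.
by apply: regx; rewrite ?permM ?g0 ?gx ?permK // groupM ?groupV.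
Qed.
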